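(* The Hochschild cohomology $H^\bullet(A,A)$ of a symmetric algebra $A$ over $k$ is a Batalin-Vilkovisky algebra.
   Context: $k$ is a commutative ring. A (unital associative) $k$-algebra $A$ is symmetric if there is an isomorphism $A\to A^*:=\mathrm{Hom}_k(A,k)$ of $A$-bimodules, where $(a\phi b)(x)=\phi(bxa)$ for $a,b,x\in A$, $\phi\in A^*$. $H^\bullet(A,A)$ is the cohomology of the Hochschild complex $C^\bullet(A,A)=\mathrm{Hom}_k(A^{\otimes\bullet},A)$, with its usual Gerstenhaber algebra structure (cup product and Gerstenhaber bracket, up to sign conventions). A Gerstenhaber algebra is a graded commutative algebra $(V,\smile)$, $V=\bigoplus_{p\in\mathbb N}V^p$, with a graded Lie bracket $\{\cdot,\cdot\}:V^{p+1}\otimes V^{q+1}\to V^{p+q+1}$ on $V[1]$ such that $\{\gamma,\alpha\smile\beta\}=\{\gamma,\alpha\}\smile\beta+(-1)^{pq}\alpha\smile\{\gamma,\beta\}$ for $\gamma\in V^{p+1},\alpha\in V^q$. It is a Batalin-Vilkovisky algebra if there is a $k$-linear $B:V^n\to V^{n-1}$, $B^2=0$, with $\{\alpha,\beta\}=(-1)^p\big(B(\alpha\smile\beta)-B(\alpha)\smile\beta-(-1)^p\alpha\smile B(\beta)\big)$ for $\alpha\in V^p$, $\beta\in V$. *)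

(* Defs.v *)
From HB Require Import structures.
From mathcomp Require Import all_boot all_algebra.
From mathcomp Require Import boolp classical_sets functions.

Set Implicit Arguments.
Unset Strict Implicit.
Unset Printing Implicit Defensive.

Import GRing.Theory.
Local Open Scope ring_scope.
Local Open Scope quotient_scope.

(* Unital associative algebras over a commutative ring.  The algType of       *)
(* MathComp requires 1 != 0; neither the base ring nor the algebra is         *)
(* required to be nontrivial here (see algebra_of_algType).                   *)
Record algebra (k : comPzRingType) := AlgebraPack {
  algebra_ring : pzRingType;
  algebra_scale : k -> algebra_ring -> algebra_ring;
  algebra_scaleA : forall a b x,
    algebra_scale a (algebra_scale b x) = algebra_scale (a * b) x;
  algebra_scale1 : left_id 1 algebra_scale;
  algebra_scaleDr : right_distributive algebra_scale +%R;
  algebra_scaleDl : forall x, {morph algebra_scale^~ x : a b / a + b};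
  algebra_scaleAl : forall a x y,
    algebra_scale a (x * y) = algebra_scale a x * y;
  algebra_scaleAr : forall a x y,
    algebra_scale a (x * y) = x * algebra_scale a y
}.

Definition algebra_sort (k : comPzRingType) (A : algebra k) : Type :=
  algebra_ring A.
Coercion algebra_sort : algebra >-> Sortclass.

HB.instance Definition _ (k : comPzRingType) (A : algebra k) :=
  GRing.PzRing.on (algebra_sort A).
HB.instance Definition _ (k : comPzRingType) (A : algebra k) :=
  GRing.Zmodule_isLmodule.Build k (algebra_sort A)
    (@algebra_scaleA k A) (@algebra_scale1 k A)
    (@algebra_scaleDr k A) (@algebra_scaleDl k A).

Lemma alg_scalerAl (k : comPzRingType) (A : algebra k) (c : k) (x y : A) :
  c *: (x * y) = (c *: x) * y.
Proof. exact: algebra_scaleAl. Qed.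

Lemma alg_scalerAr (k : comPzRingType) (A : algebra k) (c : k) (x y : A) :
  c *: (x * y) = x * (c *: y).
Proof. exact: algebra_scaleAr. Qed.

Definition algebra_of_algType (k : comPzRingType) (A : algType k) : algebra k :=
  @AlgebraPack k A *:%R (@scalerA k A) (@scale1r k A) (@scalerDr k A)
    (fun x a b => scalerDl x a b) (@scalerAl k A) (@scalerAr k A).

(* A^* = {scalar A} is the module of k-linear forms on A, with the bimodule   *)
(* structure (a u b)(x) = u (b x a).                                          *)
Definition symmetric_algebra (k : comPzRingType) (A : algebra k) : Prop :=
  exists phi : A -> {scalar A},
    [/\ bijective phi,
        forall (c : k) (a b x : A),
          phi (c *: a + b) x = c * phi a x + phi b x
      & forall a b c x : A, phi (a * b * c) x = phi b (c * x * a)].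

Section LmoduleQuotient.
Variables (k : pzRingType) (V : lmodType k) (S : zmodClosed V).
Hypothesis SZ : scaler_closed S.

Definition lmod_quot (_ : scaler_closed S) : Type := Quotient.quot S.
Local Notation quotS := (lmod_quot SZ).

HB.instance Definition _ := GRing.Zmodule.on quotS.
HB.instance Definition _ := EqQuotient.on quotS.

Definition lmod_quot_pi (x : V) : quotS := \pi_quotS x.

Definition lmod_quot_scale (c : k) (x : quotS) : quotS :=
  lmod_quot_pi (c *: repr x).

Lemma lmod_quot_eq (x y : V) :
  (lmod_quot_pi x == lmod_quot_pi y) = (x - y \in S).
Proof. by rewrite Quotient.idealrBE. Qed.

Lemma lmod_quot_piD (x y : V) :
  lmod_quot_pi (x + y) = lmod_quot_pi x + lmod_quot_pi y.
Proof. exact: raddfD. Qed.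

Lemma lmod_quot_piZ (c : k) (x : V) :
  lmod_quot_pi (c *: x) = lmod_quot_scale c (lmod_quot_pi x).
Proof.
apply/eqP; rewrite lmod_quot_eq -scalerBr SZ// -lmod_quot_eq.
by rewrite /lmod_quot_pi reprK.
Qed.

Lemma lmod_quot_piK (x : quotS) : lmod_quot_pi (repr x) = x.
Proof. exact: reprK. Qed.

Lemma lmod_quot_scalerA a b x :
  lmod_quot_scale a (lmod_quot_scale b x) = lmod_quot_scale (a * b) x.
Proof. by rewrite -[x]lmod_quot_piK -!lmod_quot_piZ scalerA. Qed.

Lemma lmod_quot_scale1r : left_id 1 lmod_quot_scale.
Proof. by move=> x; rewrite -[x]lmod_quot_piK -lmod_quot_piZ scale1r. Qed.

Lemma lmod_quot_scalerDr : right_distributive lmod_quot_scale +%R.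
Proof.
move=> a x y; rewrite -[x]lmod_quot_piK -[y]lmod_quot_piK.
by rewrite -lmod_quot_piD -!lmod_quot_piZ scalerDr lmod_quot_piD.
Qed.

Lemma lmod_quot_scalerDl x :
  {morph lmod_quot_scale^~ x : a b / a + b}.
Proof.
by move=> a b; rewrite -[x]lmod_quot_piK -!lmod_quot_piZ scalerDl lmod_quot_piD.
Qed.

HB.instance Definition _ := GRing.Zmodule_isLmodule.Build k quotS
  lmod_quot_scalerA lmod_quot_scale1r lmod_quot_scalerDr lmod_quot_scalerDl.

End LmoduleQuotient.

Section GradedAlgebras.
Variables (k : comPzRingType) (V : lmodType k) (gr : nat -> V -> Prop).

(* V is the internal direct sum of its submodules V^n = gr n.                 *)
Record graded_module : Prop := GradedModule {
  graded_zero : forall n, gr n 0;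
  graded_linear : forall n (c : k) (x y : V),
    gr n x -> gr n y -> gr n (c *: x + y);
  graded_sum : forall x : V, exists (N : nat) (c : nat -> V),
    (forall i, gr i (c i)) /\ x = \sum_(i < N) c i;
  graded_direct : forall (N : nat) (c : nat -> V),
    (forall i, gr i (c i)) -> \sum_(i < N) c i = 0 ->
    forall i, (i < N)%N -> c i = 0
}.

(* An element of V^p has degree p - 1 in V[1]; since signs only depend on     *)
(* parities, (-1)^(p - 1) is written (-1) ^+ p.+1, which also covers p = 0.   *)
Record gerstenhaber_algebra (cup br : V -> V -> V) : Prop :=
  GerstenhaberAlgebra {
  gerstenhaber_graded : graded_module;

  cup_linearl : forall y, linear (cup^~ y);
  cup_linearr : forall x, linear (cup x);
  cup_degree : forall p q x y, gr p x -> gr q y -> gr (p + q)%N (cup x y);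
  cup_associative : associative cup;
  cup_unit : exists2 e, gr 0%N e & left_id e cup /\ right_id e cup;
  cup_commutative : forall p q x y, gr p x -> gr q y ->
    cup x y = (-1) ^+ (p * q) *: cup y x;

  br_linearl : forall y, linear (br^~ y);
  br_linearr : forall x, linear (br x);
  br_degree : forall p q r x y, (p + q = r.+1)%N ->
    gr p x -> gr q y -> gr r (br x y);
  br_degree0 : forall x y, gr 0%N x -> gr 0%N y -> br x y = 0;
  br_antisymmetric : forall p q x y, gr p x -> gr q y ->
    br x y = - ((-1) ^+ (p.+1 * q.+1) *: br y x);
  br_jacobi : forall p q x y z, gr p x -> gr q y ->
    br x (br y z) = br (br x y) z + (-1) ^+ (p.+1 * q.+1) *: br y (br x z);

  br_leibniz : forall p q x y z, gr p x -> gr q y ->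
    br x (cup y z) = cup (br x y) z + (-1) ^+ (p.+1 * q) *: cup y (br x z)
}.

Record batalin_vilkovisky_algebra (cup br : V -> V -> V) : Prop :=
  BatalinVilkoviskyAlgebra {
  bv_gerstenhaber : gerstenhaber_algebra cup br;
  bv_operator : exists B : V -> V,
    [/\ linear B,
        forall n x, gr n.+1 x -> gr n (B x),
        forall x, gr 0%N x -> B x = 0,
        forall x, B (B x) = 0
      & forall p x y, gr p x ->
          br x y = (-1) ^+ p *:
            (B (cup x y) - cup (B x) y - (-1) ^+ p *: cup x (B y))]
}.

End GradedAlgebras.

Section Hochschild.
Variables (k : comPzRingType) (A : algebra k).

(* The direct sum over n of the modules C^n(A,A) = Hom_k(A^{(x) n}, A): a     *)
(* k-linear map on A^{(x) n} is a k-multilinear function of n arguments, and  *)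
(* a cochain f is the family of its restrictions to the lists of each         *)
(* length n, all but finitely many of which vanish.                           *)
Definition multilinear (f : seq A -> A) : Prop :=
  forall (s t : seq A) (c : k) (x y : A),
    f (s ++ (c *: x + y) :: t) = c *: f (s ++ x :: t) + f (s ++ y :: t).

Definition finitely_supported (f : seq A -> A) : Prop :=
  exists N : nat, forall s, (N < size s)%N -> f s = 0.

Definition cochain (f : seq A -> A) : Prop :=
  multilinear f /\ finitely_supported f.

Definition homogeneous (n : nat) (f : seq A -> A) : Prop :=
  forall s, size s != n -> f s = 0.

(* (d f)(a_0,...,a_n) = a_0 f(a_1,...,a_n)                                    *)
(*    + \sum_(i < n) (-1)^(i+1) f(a_0,...,a_i a_(i+1),...,a_n)                *)
(*    + (-1)^(n+1) f(a_0,...,a_(n-1)) a_n                                     *)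
Definition hochschild_d (f : seq A -> A) (s : seq A) : A :=
  if s is a :: t then
    a * f t
    + \sum_(i < size t)
        (-1) ^+ i.+1 *: f (take i s ++ (s`_i * s`_i.+1) :: drop i.+2 s)
    + (-1) ^+ (size s) *: (f (belast a t) * last a t)
  else 0.

Definition cocycle_pred : {pred seq A -> A} :=
  fun f => `[< cochain f /\ hochschild_d f = 0 >].

Lemma cochain_submod : cochain 0 /\
  forall c f g, cochain f -> cochain g -> cochain (c *: f + g).
Proof.
split; first split.
- by move=> s t c x y; rewrite /= scaler0 addr0.
- by exists 0%N.
move=> c f g [fl [N fN]] [gl [M gM]]; split.
  move=> s t b x y; rewrite !fctE fl gl !scalerDr !scalerA (mulrC c b).
  by rewrite addrACA.
exists (maxn N M) => s; rewrite gtn_max => /andP[Ns Ms].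
by rewrite !fctE fN// gM// scaler0 addr0.
Qed.

Lemma hochschild_d_linear : linear hochschild_d.
Proof.
move=> c f g; apply/funext => -[|a t]; rewrite !fctE /=.
  by rewrite scaler0 addr0.
rewrite mulrDr mulrDl -alg_scalerAr -alg_scalerAl.
under eq_bigr do rewrite scalerDr scalerA (mulrC _ c) -scalerA.
rewrite big_split -scaler_sumr /= scalerDr (scalerA _ c) (mulrC _ c).
rewrite -(scalerA c) !(scalerDr c) [RHS]addrACA; congr (_ + _).
exact: addrACA.
Qed.

Lemma hochschild_d0 : hochschild_d 0 = 0.
Proof.
have := hochschild_d_linear (-1) 0 0.
by rewrite scaler0 addr0 scaleN1r addNr.
Qed.

Lemma cocycle_submod_closed : submod_closed cocycle_pred.
Proof.
have [c0 cD] := cochain_submod; split.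
  by apply/asboolP; split; last exact: hochschild_d0.
move=> c f g /asboolP[fc f0] /asboolP[gc g0]; apply/asboolP; split.
  exact: cD.
by rewrite hochschild_d_linear f0 g0 scaler0 addr0.
Qed.

HB.instance Definition _ :=
  GRing.isSubmodClosed.Build k (seq A -> A) cocycle_pred cocycle_submod_closed.

Record cocycle := Cocycle {
  cocycle_val :> seq A -> A;
  _ : cocycle_val \in cocycle_pred
}.

HB.instance Definition _ := [isSub for cocycle_val].
HB.instance Definition _ := [Choice of cocycle by <:].
HB.instance Definition _ := [SubChoice_isSubLmodule of cocycle by <:].

Definition coboundary_pred : {pred cocycle} :=
  fun z => `[< exists h, cochain h /\ hochschild_d h = cocycle_val z >].

Lemma coboundary_submod_closed : submod_closed coboundary_pred.
Proof.
have [c0 cD] := cochain_submod; split.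
  by apply/asboolP; exists 0; split; last exact: hochschild_d0.
move=> c f g /asboolP[f' [fc f0]] /asboolP[g' [gc g0]]; apply/asboolP.
exists (c *: f' + g'); split; first exact: cD.
by rewrite hochschild_d_linear f0 g0.
Qed.

HB.instance Definition _ :=
  GRing.isSubmodClosed.Build k cocycle coboundary_pred coboundary_submod_closed.

Definition hochschild_cohomology : lmodType k :=
  lmod_quot (GRing.subsemimod_closedZ coboundary_submod_closed).

Definition cohomology_class (z : cocycle) : hochschild_cohomology :=
  lmod_quot_pi _ z.

Definition cohomology_degree (n : nat) (x : hochschild_cohomology) : Prop :=
  exists z : cocycle, homogeneous n z /\ cohomology_class z = x.

(* The cup product of f in C^p and g in C^q, with the Koszul sign (-1)^(pq)   *)
(* for which the Leibniz rule of gerstenhaber_algebra holds together with     *)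
(* the bracket below.                                                         *)
Definition cochain_cup (p q : nat) (f g : seq A -> A) (s : seq A) : A :=
  (-1) ^+ (p * q) *: (f (take p s) * g (drop p s)).

(* The pre-Lie product of f in C^p and g in C^q, that is                      *)
(*   \sum_(i < p) (-1)^(i(q-1)) f(a_1,...,a_i,g(a_(i+1),...,a_(i+q)),...)     *)
Definition cochain_circ (p q : nat) (f g : seq A -> A) (s : seq A) : A :=
  \sum_(i < p) (-1) ^+ (i * q.+1) *:
    f (take i s ++ g (take q (drop i s)) :: drop (i + q) s).

Definition cochain_bracket (p q : nat) (f g : seq A -> A) : seq A -> A :=
  cochain_circ p q f g - (-1) ^+ (p.+1 * q.+1) *: cochain_circ q p g f.

(* cop p q is the restriction to C^p x C^q of an operation on cochains; by    *)
(* bilinearity it is enough to describe op on homogeneous classes.            *)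
Definition induced_by
    (cop : nat -> nat -> (seq A -> A) -> (seq A -> A) -> seq A -> A)
    (op : hochschild_cohomology -> hochschild_cohomology ->
          hochschild_cohomology) : Prop :=
  forall (p q : nat) (f g : cocycle), homogeneous p f -> homogeneous q g ->
    exists h : cocycle, cocycle_val h = cop p q f g /\
      op (cohomology_class f) (cohomology_class g) = cohomology_class h.

End Hochschild.

Arguments hochschild_cohomology {k} A.
Arguments cohomology_degree {k} A n x.
Arguments cochain_cup {k} A p q f g s.
Arguments cochain_bracket {k} A p q f g _.

(* Main.v *)
Require Import Defs.
From mathcomp Require Import all_boot all_algebra.
From HB Require Import structures.
From mathcomp Require Import boolp classical_sets functions.
From mathcomp Require Import zify.

(** A cochain [f] of degree [p] acts on functions of lists by insertion:
    [ins p f G] sends a list to the signed sum of the values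
    [G (u ++ f v :: w)] over its decompositions [u ++ v ++ w]; when [G] is a
    cochain this is the pre-Lie product of [G] and [f].  Insertions are the
    transposes of the coderivations of the tensor coalgebra on [A[1]].  The
    composite of two insertions is the insertion of a pre-Lie product plus two
    simultaneous insertions [ins2] ([ins_ins]), so brackets of cochains become
    commutators ([ins_commutator]) and the Jacobi identity holds for cochains
    ([bracket_jacobi]).  The inner terms of the Hochschild differential are the
    insertion of the multiplication [cmu], its two outer terms are products
    with the identity cochain [ciota].  The insertion of a cocycle therefore
    commutes with the inner terms, up to sign ([ins_mu_comm]), and the
    differential of an insertion or of a simultaneous insertion of cocycles
    into a cocycle comes from the outer terms and from the slots next to one
    another.  This gives the homotopies for the commutativity of the cup
    product ([d_ins]) and for the Leibniz rule ([bracket_conv]).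

    When [A] is symmetric, let [tau] be its trace.  A cochain [f] is the same
    thing as the form [tau (a * f t)] in one more argument [a], and the
    Batalin-Vilkovisky operator is the transpose of the operator of Connes:
    [connes g] is represented by the signed sum of [tau (g (y ++ a :: x))] over
    the decompositions [t = x ++ y], that is over the rotations of [a :: t].
    In a cyclic sum the two outer terms of the differential cancel, whence
    [connes] anticommutes with the differential ([connes_d]); its square sends
    cocycles to coboundaries ([connes_connes]).  No normalization of the
    cochains is needed.

    For cocycles [f] and [g], consider the same cyclic sum in which [f] is
    moreover inserted among the arguments of [g] that precede [a].  Its
    differential ([d_half_homotopy]) has three terms: the one where [a] becomes
    an outer factor gives the pre-Lie product of [g] and [f], the one where [f]
    is multiplied with [a] gives the product of [connes g] and [f], and the one
    where [f] becomes an outer factor gives the rotations of the product of [f]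
    and [g] in which [a] is an argument of [g].  Those rotations and the ones in
    which [a] is an argument of [f] make up [connes (conv f g)]
    ([connes_conv]); the Batalin-Vilkovisky identity for the bracket of [f] and
    [g] is the sum of the two halves ([bracket_connes]).

    On cohomology the bracket is defined by that identity, which makes it
    bilinear at once, and [cls_bracket] identifies it with the bracket of
    cochains.  All signs depend only on parities of degrees or of lengths; the
    cochains below are mostly required to vanish on the lists of the wrong
    parity ([par]) instead of being homogeneous. *)

Set Implicit Arguments.
Unset Strict Implicit.
Unset Printing Implicit Defensive.

Import GRing.Theory.
Local Open Scope ring_scope.

(** * Signs and linear identities *)

(** Sums and opposites of numbered atoms, to decide linear identities. *)
Inductive zexp := ZAtom of nat | ZZero | ZAdd of zexp & zexp | ZOpp of zexp.

Fixpoint zeval (V : zmodType) (e : seq V) (x : zexp) : V :=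
  match x with
  | ZAtom i => e`_i
  | ZZero => 0
  | ZAdd y z => zeval e y + zeval e z
  | ZOpp y => - zeval e y
  end.

(** The coefficient of the [i]-th atom. *)
Fixpoint zcoef (i : nat) (x : zexp) : int :=
  match x with
  | ZAtom j => (i == j)%:R
  | ZZero => 0
  | ZAdd y z => zcoef i y + zcoef i z
  | ZOpp y => - zcoef i y
  end.

Lemma zeval_sum (V : zmodType) (e : seq V) x :
  zeval e x = \sum_(i < size e) e`_i *~ zcoef i x.
Proof.
elim: x => [j||y IHy z IHz|y IHy] /=.
- case: (ltnP j (size e)) => [lt_j|le_j].
    rewrite (bigD1 (Ordinal lt_j)) //= eqxx mulr1z big1 ?addr0 // => i.
    by rewrite -val_eqE /= => /negPf->; rewrite mulr0z.
  rewrite nth_default // big1 // => i _.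
  by rewrite (_ : _ == _ = false) ?mulr0z //; apply/ltn_eqF/(leq_trans _ le_j).
- by rewrite big1 // => i _; rewrite mulr0z.
- by rewrite IHy IHz -big_split /=; apply: eq_bigr => i _; rewrite mulrzDr.
- by rewrite IHy -sumrN; apply: eq_bigr => i _; rewrite mulrNz.
Qed.

Lemma zeval_eq (V : zmodType) (e : seq V) x y :
  all (fun i => zcoef i x == zcoef i y) (iota 0 (size e)) ->
  zeval e x = zeval e y.
Proof.
move=> /allP eq_xy; rewrite !zeval_sum; apply: eq_bigr => i _.
by rewrite (eqP (eq_xy i _)) // mem_iota /= add0n.
Qed.

Ltac zmem x e :=
  lazymatch e with
  | nil => constr:(false)
  | x :: _ => constr:(true)
  | _ :: ?e' => zmem x e'
  end.

Ltac zindex x e :=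
  lazymatch e with
  | x :: _ => constr:(0%N)
  | _ :: ?e' => let i := zindex x e' in constr:(S i)
  end.

Ltac zatoms t e :=
  lazymatch t with
  | 0 => e
  | ?a + ?b => let e' := zatoms a e in zatoms b e'
  | - ?a => zatoms a e
  | ?a => lazymatch zmem a e with
          | true => e
          | false => constr:(a :: e)
          end
  end.

Ltac zquote t e :=
  lazymatch t with
  | 0 => constr:(ZZero)
  | ?a + ?b => let x := zquote a e in let y := zquote b e in
               constr:(ZAdd x y)
  | - ?a => let x := zquote a e in constr:(ZOpp x)
  | ?a => let i := zindex a e in constr:(ZAtom i)
  end.

(** Decides equations in abelian groups, comparing coefficients. *)
Ltac abel :=
  lazymatch goal with
  | |- @eq ?T ?a ?b =>
    let e0 := constr:(@nil T) in
    let e1 := zatoms a e0 in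
    let e := zatoms b e1 in
    let x := zquote a e in
    let y := zquote b e in
    exact: (@zeval_eq _ e x y isT)
  end.

Lemma eq_sign (R : pzRingType) m n :
  odd m = odd n -> (-1) ^+ m = (-1) ^+ n :> R.
Proof. by move=> eq_mn; rewrite -signr_odd eq_mn signr_odd. Qed.

Lemma signS (R : pzRingType) (V : lmodType R) n (v : V) :
  (-1) ^+ n.+1 *: v = - ((-1) ^+ n *: v).
Proof. by rewrite exprS mulN1r scaleNr. Qed.

Lemma signE (R : pzRingType) (V : lmodType R) n (v : V) :
  (-1) ^+ n *: v = if odd n then - v else v.
Proof. by rewrite -signr_odd scaler_sign. Qed.

(** Decides equalities of parities by a case analysis on the parities of the
    atoms. *)
Ltac parity :=
  repeat match goal with H : odd _ = odd _ |- _ => revert H end;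
  rewrite ?(size_cat, size_rcons) /= ?(size_cat, size_rcons) /=;
  rewrite ?(oddD, oddM) /= ?(oddD, oddM) /= ?(oddD, oddM) /=;
  repeat match goal with |- context [odd ?n] => case: (odd n) => //= end.

(** Compares two multiples of the same vector by powers of -1. *)
Ltac sgn :=
  rewrite ?scalerA -?exprD; congr (_ *: _); apply: eq_sign; parity.

(** Decides linear identities whose coefficients are powers of -1. *)
Ltac signed_abel :=
  rewrite ?signE ?(oddD, oddM) /= ?(oddD, oddM) /= ?(oddD, oddM) /=;
  repeat match goal with |- context [odd ?n] => case: (odd n) => /= end;
  abel.

(** * Sums over the ways to cut a list *)

Section Cut.
Variable T : Type.
Implicit Types (V W : zmodType) (s t u v w : seq T).

(** [cut s P] is the sum of [P u v] over the decompositions [s = u ++ v]. *)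
Fixpoint cut V s (P : seq T -> seq T -> V) : V :=
  if s is a :: t then P [::] s + cut t (fun u v => P (a :: u) v)
  else P [::] [::].

Lemma eq_cut V s (P Q : seq T -> seq T -> V) :
  (forall u v, s = u ++ v -> P u v = Q u v) -> cut s P = cut s Q.
Proof.
elim: s P Q => [|a s IHs] P Q eqPQ /=; first exact: eqPQ.
by rewrite eqPQ //; congr (_ + _); apply: IHs => u v e; apply: eqPQ; rewrite e.
Qed.

Lemma cut_zero V s (P : seq T -> seq T -> V) :
  (forall u v, s = u ++ v -> P u v = 0) -> cut s P = 0.
Proof.
elim: s P => [|a s IHs] P P0 /=; first exact: P0.
by rewrite P0 // add0r; apply: IHs => u v e; apply: P0; rewrite e.
Qed.

Lemma cutD V s (P Q : seq T -> seq T -> V) :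
  cut s (fun u v => P u v + Q u v) = cut s P + cut s Q.
Proof. by elim: s P Q => [|a s IHs] P Q //=; rewrite IHs addrACA. Qed.

Lemma cut_raddf V W (f : V -> W) s (P : seq T -> seq T -> V) :
  {morph f : x y / x + y} -> f (cut s P) = cut s (fun u v => f (P u v)).
Proof. by move=> fD; elim: s P => [|a s IHs] P //=; rewrite fD IHs. Qed.

Lemma cutN V s (P : seq T -> seq T -> V) :
  cut s (fun u v => - P u v) = - cut s P.
Proof. by rewrite (cut_raddf (f := -%R)) //; apply: opprD. Qed.

Lemma cutB V s (P Q : seq T -> seq T -> V) :
  cut s (fun u v => P u v - Q u v) = cut s P - cut s Q.
Proof. by rewrite cutD cutN. Qed.

Lemma cutZ (k : pzRingType) (V : lmodType k) s c (P : seq T -> seq T -> V) :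
  c *: cut s P = cut s (fun u v => c *: P u v).
Proof. by apply: (cut_raddf (f := *:%R c)); apply: scalerDr. Qed.

(** Cutting into three pieces does not depend on the order of the cuts. *)
Lemma cutA V s (P : seq T -> seq T -> seq T -> V) :
  cut s (fun u r => cut r (fun v w => P u v w)) =
  cut s (fun r w => cut r (fun u v => P u v w)).
Proof.
elim: s P => [|a s IHs] P //=.
by rewrite IHs -addrA; congr (_ + _); rewrite cutD.
Qed.

(** Only one trivial cut contributes if [P] vanishes on nonempty left pieces,
    or on nonempty right pieces. *)
Lemma cut_l0 V s (P : seq T -> seq T -> V) :
  (forall a u v, P (a :: u) v = 0) -> cut s P = P [::] s.
Proof.
by case: s => [|a s] //= P0; rewrite cut_zero ?addr0.
Qed.

Lemma cut_r0 V s (P : seq T -> seq T -> V) :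
  (forall u a v, P u (a :: v) = 0) -> cut s P = P s [::].
Proof. by elim: s P => [|a s IHs] P //= P0; rewrite P0 add0r IHs. Qed.

Lemma cutE V s (P : seq T -> seq T -> V) :
  cut s P = \sum_(i < (size s).+1) P (take i s) (drop i s).
Proof.
elim: s P => [|a s IHs] P /=; first by rewrite big_ord_recl big_ord0 addr0.
by rewrite big_ord_recl IHs.
Qed.

(** A cut of [u ++ a :: v] lies before or after [a]. *)
Lemma cut_cat_cons V u a v (P : seq T -> seq T -> V) :
  cut (u ++ a :: v) P = cut u (fun u1 u2 => P u1 (u2 ++ a :: v)) +
                        cut v (fun v1 v2 => P (u ++ a :: v1) v2).
Proof. by elim: u P => [|b u IHu] P //=; rewrite IHu addrA. Qed.

Lemma cut_exchange V s t (P : seq T -> seq T -> seq T -> seq T -> V) :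
  cut s (fun u v => cut t (P u v)) =
  cut t (fun u' v' => cut s (fun u v => P u v u' v')).
Proof.
elim: s P => [|a s IHs] P //=.
by rewrite IHs cutD.
Qed.

(** Cutting a list into five pieces. *)
Lemma cut5 V s (P : seq T -> seq T -> seq T -> seq T -> seq T -> V) :
  cut s (fun x r => cut r (fun y z => cut x (fun x1 x2 => cut z (fun z1 z2 =>
    P x1 x2 y z1 z2)))) =
  cut s (fun x1 r => cut r (fun y' z2 => cut y' (fun x2 r' =>
    cut r' (fun y z1 => P x1 x2 y z1 z2)))).
Proof.
transitivity (cut s (fun x r => cut x (fun x1 x2 => cut r (fun w z2 =>
    cut w (fun y z1 => P x1 x2 y z1 z2))))).
  apply: eq_cut => x r _; rewrite cut_exchange; apply: eq_cut => x1 x2 _.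
  by rewrite cutA.
by rewrite -cutA; apply: eq_cut => x1 r _; rewrite cutA.
Qed.

End Cut.

(** * Multilinear functions of lists *)

Section Multilinear.
Variables (k : comPzRingType) (A : algebra k).
Implicit Types (V W : lmodType k) (r s t u v w : seq A) (x y : A).

(** The analogue of [multilinear] for values in an arbitrary module. *)
Definition mlin V (G : seq A -> V) : Prop :=
  forall s t (c : k) x y,
    G (s ++ (c *: x + y) :: t) = c *: G (s ++ x :: t) + G (s ++ y :: t).

Lemma mlin_ext V (G H : seq A -> V) : G =1 H -> mlin G -> mlin H.
Proof. by move=> eqGH Gl s t c x y; rewrite -!eqGH. Qed.

Lemma mlin_comb V (G H : seq A -> V) (c : k) :
  mlin G -> mlin H -> mlin (fun s => c *: G s + H s).
Proof.
move=> Gl Hl s t b x y; rewrite Gl Hl !scalerDr !scalerA (mulrC c b).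
by rewrite addrACA.
Qed.

Lemma mlin0 V : mlin (fun=> 0 : V).
Proof. by move=> s t c x y; rewrite scaler0 addr0. Qed.

Lemma mlinD V (G H : seq A -> V) :
  mlin G -> mlin H -> mlin (fun s => G s + H s).
Proof.
by move=> Gl /(mlin_comb 1 Gl); apply: mlin_ext => s; rewrite scale1r.
Qed.

Lemma mlinZ V (G : seq A -> V) (c : k) : mlin G -> mlin (fun s => c *: G s).
Proof.
by move=> /(mlin_comb c)/(_ (@mlin0 V)); apply: mlin_ext => s; rewrite addr0.
Qed.

Lemma mlinN V (G : seq A -> V) : mlin G -> mlin (fun s => - G s).
Proof. by move=> /(mlinZ (-1)); apply: mlin_ext => s; rewrite scaleN1r. Qed.

Lemma mlinB V (G H : seq A -> V) :
  mlin G -> mlin H -> mlin (fun s => G s - H s).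
Proof. by move=> Gl /mlinN; apply: mlinD. Qed.

(** A sign, or any coefficient, that only depends on the number of
    arguments does not affect multilinearity. *)
Lemma mlin_size V (c : nat -> k) (G : seq A -> V) :
  mlin G -> mlin (fun s => c (size s) *: G s).
Proof.
move=> Gl s t b x y; rewrite Gl !size_cat /= scalerDr !scalerA.
by rewrite (mulrC b).
Qed.

Lemma mlin_cut V (P : seq A -> seq A -> V) :
  (forall v, mlin (fun u => P u v)) -> (forall u, mlin (P u)) ->
  mlin (fun s => cut s P).
Proof.
move=> Pl Pr s t c x y; rewrite !cut_cat_cons.
rewrite (eq_cut (P := fun u v => P u (v ++ (c *: x + y) :: t))
  (Q := fun u v => c *: P u (v ++ x :: t) + P u (v ++ y :: t))); last first.
  by move=> u v _; rewrite Pr.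
rewrite (eq_cut (P := fun u v => P (s ++ (c *: x + y) :: u) v)
  (Q := fun u v => c *: P (s ++ x :: u) v + P (s ++ y :: u) v)); last first.
  by move=> u v _; rewrite Pl.
rewrite !cutD scalerDr !cutZ.
exact: addrACA.
Qed.

Lemma mlin_sum V r (P : seq A -> seq A -> seq A -> V) :
  (forall v w, mlin (fun u => P u v w)) -> mlin (fun u => cut r (P u)).
Proof.
move=> Pl s t c x y; rewrite cutZ -cutD.
by apply: eq_cut => v w _; rewrite Pl.
Qed.

Lemma mlin_head V (G : seq A -> V) u : mlin G -> mlin (fun s => G (u ++ s)).
Proof. by move=> Gl s t c x y; rewrite !catA Gl. Qed.

Lemma mlin_tail V (G : seq A -> V) u : mlin G -> mlin (fun s => G (s ++ u)).
Proof. by move=> Gl s t c x y; rewrite -!catA /= Gl. Qed.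

Lemma mlin_slot V (G : seq A -> V) (f : seq A -> A) u w :
  mlin G -> mlin f -> mlin (fun v => G (u ++ f v :: w)).
Proof. by move=> Gl fl s t c x y; rewrite fl Gl. Qed.

Lemma slotD V (G : seq A -> V) u w : mlin G ->
  {morph (fun x => G (u ++ x :: w)) : x y / x + y}.
Proof. by move=> Gl x y /=; have := Gl u w 1 x y; rewrite !scale1r. Qed.

Lemma slot0 V (G : seq A -> V) u w : mlin G -> G (u ++ 0 :: w) = 0.
Proof.
move=> Gl; have /eqP := slotD u w Gl 0 0; rewrite addr0.
by rewrite -subr_eq subrr => /eqP <-.
Qed.

Lemma slotZ V (G : seq A -> V) u w c x : mlin G ->
  G (u ++ c *: x :: w) = c *: G (u ++ x :: w).
Proof. by move=> Gl; have := Gl u w c x 0; rewrite !addr0 slot0 // addr0. Qed.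

Lemma slot_cut V (G : seq A -> V) u w s (P : seq A -> seq A -> A) :
  mlin G ->
  G (u ++ cut s P :: w) = cut s (fun v v' => G (u ++ P v v' :: w)).
Proof. 
move=> Gl; apply: (cut_raddf (f := fun x => G (u ++ x :: w))).
exact: slotD.
 Qed.

Lemma mlin_comp V W (L : V -> W) (G : seq A -> V) :
  linear L -> mlin G -> mlin (fun s => L (G s)).
Proof. by move=> Ll Gl s t c x y; rewrite Gl Ll. Qed.

(** [par p G]: the function [G] vanishes on the lists whose length does not
    have the parity of [p]. *)
Definition par V (p : nat) (G : seq A -> V) : Prop :=
  forall s, odd (size s) != odd p -> G s = 0.

Lemma par_case V p (G : seq A -> V) s :
  par p G -> G s = 0 \/ odd (size s) = odd p.
Proof.
by move=> Gp; case: (boolP (odd (size s) == odd p)) => [/eqP|/Gp]; [right|left].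
Qed.

Lemma par_ext V p (G H : seq A -> V) : G =1 H -> par p G -> par p H.
Proof. by move=> eqGH Gp s /Gp; rewrite eqGH. Qed.

(** [supp N G]: the function [G] vanishes on the lists of length at least
    [N]. *)
Definition supp V (N : nat) (G : seq A -> V) : Prop :=
  forall s, (N <= size s)%N -> G s = 0.

End Multilinear.

(** * Insertions *)

Section Insertion.
Variables (k : comPzRingType) (A : algebra k).
Implicit Types (V W : lmodType k) (r s t u v w x y z : seq A) (a b : A).
Implicit Types (f g h : seq A -> A) (p q : nat).

(** The coderivation of the tensor coalgebra on the shifted module [A[1]]
    defined by a cochain [f] of degree [p], acting on functions of lists. *)
Definition ins V p f (G : seq A -> V) s : V :=
  cut s (fun u r => cut r (fun v w =>
    (-1) ^+ (size u * p.+1) *: G (u ++ f v :: w))).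

Lemma eq_ins V p f (G H : seq A -> V) s : G =1 H -> ins p f G s = ins p f H s.
Proof.
by move=> e; apply: eq_cut => u r _; apply: eq_cut => v w _; rewrite e.
Qed.

Lemma ins_odd V p q f (G : seq A -> V) s :
  odd p = odd q -> ins p f G s = ins q f G s.
Proof.
by move=> e; apply: eq_cut => u r _; apply: eq_cut => v w _; sgn.
Qed.

Lemma insD V p f (G H : seq A -> V) s :
  ins p f (fun s => G s + H s) s = ins p f G s + ins p f H s.
Proof.
rewrite -cutD; apply: eq_cut => u r _; rewrite -cutD; apply: eq_cut => v w _.
by rewrite scalerDr.
Qed.

Lemma ins_eq0 V p f (G : seq A -> V) s :
  (forall t, G t = 0) -> ins p f G s = 0.
Proof.
move=> G0; apply: cut_zero => u r _; apply: cut_zero => v w _.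
by rewrite G0 scaler0.
Qed.

Lemma insZ V p f (G : seq A -> V) c s :
  ins p f (fun s => c *: G s) s = c *: ins p f G s.
Proof.
rewrite cutZ; apply: eq_cut => u r _; rewrite cutZ; apply: eq_cut => v w _.
by rewrite !scalerA mulrC.
Qed.

Lemma insN V p f (G : seq A -> V) s :
  ins p f (fun s => - G s) s = - ins p f G s.
Proof. by rewrite -scaleN1r -insZ; apply: eq_ins => t; rewrite scaleN1r. Qed.

Lemma insB V p f (G H : seq A -> V) s :
  ins p f (fun s => G s - H s) s = ins p f G s - ins p f H s.
Proof. by rewrite insD insN. Qed.

Lemma ins_comp V W p f (L : V -> W) (G : seq A -> V) s : linear L ->
  ins p f (fun s => L (G s)) s = L (ins p f G s).
Proof.
move=> Ll; have LD : {morph L : x y / x + y}.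
  by move=> x y; have := Ll 1 x y; rewrite !scale1r.
have L0 : L 0 = 0 by apply: (@addrI _ (L 0)); rewrite -LD !addr0.
rewrite /ins (cut_raddf (f := L)) //; apply: eq_cut => u r _.
rewrite (cut_raddf (f := L)) //; apply: eq_cut => v w _.
by have := Ll ((-1) ^+ (size u * p.+1)) (G (u ++ f v :: w)) 0;
  rewrite L0 !addr0 => ->.
Qed.

Lemma ins_comb V p f g (G : seq A -> V) c s : mlin G ->
  ins p (fun t => c *: f t + g t) G s = c *: ins p f G s + ins p g G s.
Proof.
move=> Gl; rewrite cutZ -cutD; apply: eq_cut => u r _.
rewrite cutZ -cutD; apply: eq_cut => v w _.
by rewrite Gl scalerDr !scalerA mulrC.
Qed.

Lemma ins0f V p (G : seq A -> V) s : mlin G -> ins p (fun=> 0) G s = 0.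
Proof.
move=> Gl; apply: cut_zero => u r _; apply: cut_zero => v w _.
by rewrite slot0 // scaler0.
Qed.

Lemma insZf V p f (G : seq A -> V) c s : mlin G ->
  ins p (fun t => c *: f t) G s = c *: ins p f G s.
Proof.
move=> Gl; have := ins_comb p f (fun=> 0) c s Gl.
rewrite ins0f // addr0 => <-; congr (ins p _ G s).
by apply/funext => t; rewrite addr0.
Qed.

Lemma mlin_ins V p f (G : seq A -> V) : mlin f -> mlin G -> mlin (ins p f G).
Proof.
move=> fl Gl; apply: mlin_cut => [r|u].
  apply: mlin_sum => v w.
  apply: (@mlin_size _ _ _ (fun n => (-1) ^+ (n * p.+1))
            (fun u => G (u ++ f v :: w))).
  exact: mlin_tail.
apply: mlin_cut => [w|v]; apply: mlinZ; first exact: mlin_slot.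
by apply: mlin_ext (mlin_head (rcons u (f v)) Gl) => s; rewrite cat_rcons.
Qed.

Lemma mlin_ins_param V p f s (P : seq A -> seq A -> V) :
  (forall t, mlin (P^~ t)) -> mlin (fun u => ins p f (P u) s).
Proof.
move=> Pl u v c x y; rewrite -insZ -insD; apply: eq_ins => t.
exact: (Pl t).
Qed.

(** Inserting [f] replaces arguments by one value, so parities add up to one
    more. *)
Lemma par_ins V p q f (G : seq A -> V) :
  par p f -> par q G -> mlin G -> par (p + q).+1 (ins p f G).
Proof.
move=> fp Gq Gl s Ns; apply: cut_zero => u r es; apply: cut_zero => v w er.
have [->|fv] := par_case v fp; first by rewrite slot0 // scaler0.
rewrite Gq ?scaler0 //; apply: contra Ns => /eqP; rewrite es er.
by move=> e; apply/eqP; parity.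
Qed.

Lemma supp_ins V p M N f (G : seq A -> V) :
  supp M f -> supp N G -> mlin G -> supp (M + N) (ins p f G).
Proof.
move=> fM GN Gl s Ns; apply: cut_zero => u r es; apply: cut_zero => v w er.
case: (leqP M (size v)) => [/fM ->|lt_v]; first by rewrite slot0 // scaler0.
rewrite GN ?scaler0 //; move: Ns lt_v; rewrite es er !size_cat /=; lia.
Qed.

(** [ins p f] is a coderivation. *)
Lemma ins_cut V p f (P : seq A -> seq A -> V) s :
  ins p f (fun t => cut t P) s =
  cut s (fun u v => ins p f (P^~ v) u +
                    (-1) ^+ (size u * p.+1) *: ins p f (P u) v).
Proof.
transitivity (cut s (fun u r => cut r (fun v w =>
    cut u (fun u1 u2 => (-1) ^+ (size u * p.+1) *: P u1 (u2 ++ f v :: w)))) +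
  cut s (fun u r => cut r (fun v w =>
    cut w (fun w1 w2 => (-1) ^+ (size u * p.+1) *: P (u ++ f v :: w1) w2)))).
  rewrite -cutD; apply: eq_cut => u r _; rewrite -cutD.
  by apply: eq_cut => v w _; rewrite cut_cat_cons scalerDr !cutZ.
rewrite addrC cutD; congr (_ + _).
  rewrite -cutA; apply: eq_cut => u r _.
  by rewrite cutA.
rewrite (eq_cut (Q := fun u r => cut u (fun u1 u2 => cut r (fun v w =>
    (-1) ^+ (size (u1 ++ u2) * p.+1) *: P u1 (u2 ++ f v :: w)))))%R; last first.
  by move=> u r _; rewrite cut_exchange; apply: eq_cut => u1 u2 ->.
rewrite -cutA; apply: eq_cut => u r _; rewrite cutZ; apply: eq_cut => v w _.
rewrite cutZ; apply: eq_cut => v' w' _; rewrite scalerA -exprD.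
by congr (_ *: _); apply: eq_sign; parity.
Qed.

Lemma ins_sum V p f s t (P : seq A -> seq A -> seq A -> V) :
  ins p f (fun u => cut t (P u)) s =
  cut t (fun v w => ins p f (fun u => P u v w) s).
Proof.
elim: t P => [|a t IHt] P //=.
by rewrite insD IHt.
Qed.

(** The insertion of [f] shortens a list by the degree of [f] minus 1,
    which affects the signs that depend on its length. *)
Lemma ins_size V p m f (G : seq A -> V) s : par p f -> mlin G ->
  ins p f (fun t => (-1) ^+ (size t * m) *: G t) s =
  (-1) ^+ ((size s + p).+1 * m) *: ins p f G s.
Proof.
move=> fp Gl; rewrite cutZ; apply: eq_cut => u r es; rewrite cutZ.
apply: eq_cut => v w er; have [->|fv] := par_case v fp.
  by rewrite slot0 // !scaler0.
by rewrite es er; sgn.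
Qed.

(** Inserting [f] among the arguments of [g] inside [G] is inserting the
    pre-Lie product of [g] and [f]. *)
Lemma ins_slot V p f g (G : seq A -> V) u w s : mlin G ->
  ins p f (fun v => G (u ++ g v :: w)) s = G (u ++ ins p f g s :: w).
Proof.
move=> Gl; rewrite slot_cut //; apply: eq_cut => v r _.
by rewrite slot_cut //; apply: eq_cut => v' w' _; rewrite slotZ.
Qed.

(** The simultaneous insertion of [f] and [g], with [f] on the left of [g]. *)
Definition ins2 V p f q g (G : seq A -> V) s : V :=
  cut s (fun u r => cut r (fun v w =>
    (-1) ^+ (size u * q.+1) *: ins p f (fun u => G (u ++ g v :: w)) u)).

(** The two insertions can be performed in either order. *)
Lemma ins2_right V p f q g (G : seq A -> V) s : par p f -> mlin G ->
  ins2 p f q g G s =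
  cut s (fun u r => cut r (fun v w =>
    (-1) ^+ (size u * p.+1 + (size u + p) * q.+1) *:
      ins q g (fun w => G (u ++ f v :: w)) w)).
Proof.
move=> fp Gl.
pose F u v w y z := (-1) ^+ (size u * p.+1 + (size u + p + size w) * q.+1) *:
  G (u ++ f v :: w ++ g y :: z).
transitivity (cut s (fun x r => cut x (fun u x' => cut x' (fun v w =>
  cut r (fun y z => F u v w y z))))).
  apply: eq_cut => x r _.
  rewrite [RHS](eq_cut (Q := fun u x' => cut r (fun y z => cut x' (fun v w =>
    F u v w y z)))); last by move=> u x' _; rewrite cut_exchange.
  rewrite -cut_exchange; apply: eq_cut => y z _; rewrite cutZ.
  apply: eq_cut => u x' ex; rewrite cutZ; apply: eq_cut => v w ex'.
  rewrite /F -catA /=; have [->|fv] := par_case v fp.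
    by rewrite slot0 // !scaler0.
  by rewrite ex ex'; sgn.
rewrite -cutA; apply: eq_cut => u r _; rewrite -cutA; apply: eq_cut => v w' _.
rewrite cutZ; apply: eq_cut => w r' _; rewrite cutZ; apply: eq_cut => y z _.
by rewrite /F; sgn.
Qed.

(** The failure of [f |-> ins p f] to be multiplicative. *)
Lemma ins_ins V p f q g (G : seq A -> V) s :
  par p f -> par q g -> mlin f -> mlin g -> mlin G ->
  ins q g (ins p f G) s =
  (-1) ^+ (p.+1 * q.+1) *: ins2 q g p f G s + ins2 p f q g G s +
  ins (p + q).+1 (ins q g f) G s.
Proof.
move=> fp gq fl gl Gl; rewrite (@ins2_right _ p f) // /ins2 cutZ -cutD.
rewrite -cutD ins_cut; apply: eq_cut => u r es; rewrite ins_sum ins_cut cutZ.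
rewrite cutZ -!cutD; apply: eq_cut => v w er.
rewrite ins_size //; last exact: mlin_tail.
rewrite insZ (ins_slot _ _ _ _ _ _ Gl) insZ !scalerDr addrA addrAC.
congr (_ + _ + _); [by sgn| |by sgn].
have [fv0|fv] := par_case v fp; last by sgn.
by rewrite !(@ins_eq0 _ _ _ (fun w => G (u ++ f v :: w))) ?scaler0 // => t;
  rewrite fv0 slot0.
Qed.

(** The map [f |-> ins p f] takes Gerstenhaber brackets to commutators. *)
Lemma ins_commutator V p f q g (G : seq A -> V) s :
  par p f -> par q g -> mlin f -> mlin g -> mlin G ->
  ins q g (ins p f G) s - (-1) ^+ (p.+1 * q.+1) *: ins p f (ins q g G) s =
  ins (p + q).+1 (ins q g f) G s -
    (-1) ^+ (p.+1 * q.+1) *: ins (p + q).+1 (ins p f g) G s.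
Proof.
move=> fp gq fl gl Gl; rewrite (ins_ins _ fp gq) // (ins_ins _ gq fp) //.
rewrite (mulnC q.+1) (addnC q p).
signed_abel.
Qed.
End Insertion.

(** * The Hochschild differential *)

Section Differential.
Variables (k : comPzRingType) (A : algebra k).
Implicit Types (V W : lmodType k) (r s t u v w x y z : seq A) (a b : A).
Implicit Types (f g h : seq A -> A) (p q : nat).

(** The cup product without signs. *)
Definition conv f g s : A := cut s (fun u v => f u * g v).

(** The unit, the identity of [A] and the multiplication of [A], as cochains
    of degree 0, 1 and 2. *)
Definition cone s : A := if s is [::] then 1 else 0.
Definition ciota s : A := if s is [:: a] then a else 0.
Definition cmu : seq A -> A := conv ciota ciota.

Lemma eq_conv f f' g g' : f =1 f' -> g =1 g' -> conv f g =1 conv f' g'.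
Proof. by move=> ef eg s; apply: eq_cut => u v _; rewrite ef eg. Qed.

Lemma convA f g h s : conv f (conv g h) s = conv (conv f g) h s.
Proof.
rewrite /conv.
transitivity (cut s (fun u r => cut r (fun v w => f u * g v * h w))).
  apply: eq_cut => u r _.
  rewrite (cut_raddf (f := *%R (f u))); last exact: mulrDr.
  by apply: eq_cut => v w _; rewrite mulrA.
rewrite cutA; apply: eq_cut => u r _.
by rewrite (cut_raddf (f := *%R^~ (h r))) // => a b; rewrite mulrDl.
Qed.

Lemma convDl f f' g s :
  conv (fun t => f t + f' t) g s = conv f g s + conv f' g s.
Proof. by rewrite -cutD; apply: eq_cut => u v _; rewrite mulrDl. Qed.

Lemma convDr f g g' s :
  conv f (fun t => g t + g' t) s = conv f g s + conv f g' s.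
Proof. by rewrite -cutD; apply: eq_cut => u v _; rewrite mulrDr. Qed.

Lemma convNl f g s : conv (fun t => - f t) g s = - conv f g s.
Proof. by rewrite -cutN; apply: eq_cut => u v _; rewrite mulNr. Qed.

Lemma convNr f g s : conv f (fun t => - g t) s = - conv f g s.
Proof. by rewrite -cutN; apply: eq_cut => u v _; rewrite mulrN. Qed.

Lemma convBl f f' g s :
  conv (fun t => f t - f' t) g s = conv f g s - conv f' g s.
Proof. by rewrite convDl convNl. Qed.

Lemma convBr f g g' s :
  conv f (fun t => g t - g' t) s = conv f g s - conv f g' s.
Proof. by rewrite convDr convNr. Qed.

Lemma convZl c f g s : conv (fun t => c *: f t) g s = c *: conv f g s.
Proof. by rewrite cutZ; apply: eq_cut => u v _; rewrite alg_scalerAl. Qed.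

Lemma convZr c f g s : conv f (fun t => c *: g t) s = c *: conv f g s.
Proof. by rewrite cutZ; apply: eq_cut => u v _; rewrite alg_scalerAr. Qed.

Lemma conv1l f s : conv cone f s = f s.
Proof.
by rewrite /conv cut_l0 /= ?mul1r // => a u v; rewrite mul0r.
Qed.

Lemma conv1r f s : conv f cone s = f s.
Proof.
by rewrite /conv cut_r0 /= ?mulr1 // => u a v; rewrite mulr0.
Qed.

Lemma conv_iota_nil f : conv ciota f [::] = 0.
Proof. by rewrite /conv /= mul0r. Qed.

Lemma conv_iota_cons f a s : conv ciota f (a :: s) = a * f s.
Proof.
rewrite /conv /= mul0r add0r cut_l0 // => b u v.
by rewrite mul0r.
Qed.

Lemma conv_iotar_nil f : conv f ciota [::] = 0.
Proof. by rewrite /conv /= mulr0. Qed.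

Lemma conv_iota_rcons f s a : conv f ciota (rcons s a) = f s * a.
Proof.
rewrite -cats1 /conv cut_cat_cons /= mulr0 addr0 cut_r0 // => u b v.
by case: v => [|c v]; rewrite /= mulr0.
Qed.

Lemma mlin_conv f g : mlin f -> mlin g -> mlin (conv f g).
Proof.
move=> fl gl; apply: mlin_cut => [v|u] s t c x y.
  by rewrite fl mulrDl -alg_scalerAl.
by rewrite gl mulrDr -alg_scalerAr.
Qed.

Lemma par_conv p q f g : par p f -> par q g -> par (p + q) (conv f g).
Proof.
move=> fp gq s Ns; apply: cut_zero => u v es.
have [->|fu] := par_case u fp; first by rewrite mul0r.
rewrite [g v]gq ?mulr0 //; apply: contra Ns => /eqP; rewrite es => gv.
by apply/eqP; parity.
Qed.

Lemma mlin_one : mlin cone.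
Proof.
by move=> [|a s] t c x y; rewrite /= scaler0 addr0.
Qed.

Lemma mlin_iota : mlin ciota.
Proof.
move=> [|a [|a' s]] [|b t] c x y //=; rewrite ?scaler0 ?addr0 //.
Qed.

Lemma par_iota : par 1 ciota.
Proof. by case=> [|a []]. Qed.

Lemma mlin_mu : mlin cmu.
Proof. exact: mlin_conv mlin_iota mlin_iota. Qed.

Lemma par_mu : par 2 cmu.
Proof. exact: par_conv par_iota par_iota. Qed.

(** Insertions are graded derivations of the product. *)
Lemma ins_conv p q f g h s : par p f ->  par q h -> mlin f ->
  ins q h (conv f g) s =
  conv (ins q h f) g s + (-1) ^+ (p * q.+1) *: conv f (ins q h g) s.
Proof.
move=> fp hq fl; rewrite ins_cut cutZ -cutD; apply: eq_cut => u v _.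
rewrite (ins_comp _ _ (L := fun a : A => a * g v)) => [|c a b]; last first.
  by rewrite mulrDl -alg_scalerAl.
rewrite (ins_comp _ _ (L := fun a : A => f u * a)) => [|c a b]; last first.
  by rewrite mulrDr -alg_scalerAr.
have [->|fu] := par_case u fp; first by rewrite mul0r !scaler0.
by congr (_ + _); sgn.
Qed.

Lemma ins_one p f s : ins p f cone s = 0.
Proof.
apply: cut_zero => u r _; apply: cut_zero => v w _.
by case: u => [|a u]; rewrite /= scaler0.
Qed.

Lemma ins_iota p f s : ins p f ciota s = f s.
Proof.
rewrite /ins cut_l0 => [|a u v].
  rewrite cut_r0 => [|u a v]; first by rewrite /= expr0 scale1r.
  by rewrite /= scaler0.
by apply: cut_zero => x y _; case: u => [|b u]; rewrite /= scaler0.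
Qed.

(** The pre-Lie product of the multiplication with [f] is made of the outer
    terms of the differential of [f]. *)
Lemma ins_mu p f s : par p f ->
  ins p f cmu s = conv f ciota s + (-1) ^+ p.+1 *: conv ciota f s.
Proof.
move=> fp; rewrite (ins_conv _ _ par_iota fp mlin_iota) mul1n.
by rewrite (eq_conv (@ins_iota p f) (frefl _)) (eq_conv (frefl _) (@ins_iota p
  f)).
Qed.

(** The inner part of the differential, by recursion on the list. *)
Lemma mu_ins_cons V (G : seq A -> V) a s : mlin G ->
  ins 2 cmu G (a :: s) =
  (if s is b :: t then G (a * b :: t) else 0) -
  ins 2 cmu (fun t => G (a :: t)) s.
Proof.
move=> Gl; have G0 t : G (0 :: t) = 0 by have := slot0 [::] t Gl.
rewrite /ins [LHS]/=; congr (_ + _); last first.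
  rewrite -cutN; apply: eq_cut => u r _; rewrite -cutN; apply: eq_cut => v w _.
  by rewrite -signS; sgn.
rewrite expr0 scale1r /cmu conv_iotar_nil G0 add0r.
case: s => [|b s] /=; rewrite ?scale1r conv_iota_cons /= mulr0 G0 //.
rewrite add0r cut_l0 => [|c u v]; first by rewrite scale1r conv_iota_cons.
by rewrite conv_iota_cons mulr0 G0 scaler0.
Qed.

Lemma mu_ins_nil V (G : seq A -> V) : mlin G -> ins 2 cmu G [::] = 0.
Proof.
move=> Gl; rewrite /ins /= /cmu conv_iotar_nil.
by have := slot0 [::] [::] Gl => /= ->; rewrite scaler0.
Qed.

Lemma mu_insE V (G : seq A -> V) a t : mlin G ->
  ins 2 cmu G (a :: t) =
  \sum_(i < size t) (-1) ^+ i *: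
    G (take i (a :: t) ++ ((a :: t)`_i * (a :: t)`_i.+1) :: drop i.+2 (a :: t)).
Proof.
elim: t a G => [|b t IHt] a G Gl; rewrite mu_ins_cons //.
  by rewrite big_ord0 mu_ins_nil ?subr0 //; apply: (mlin_head [:: a]).
rewrite IHt; last exact: (mlin_head [:: a]).
rewrite big_ord_recl /= expr0 scale1r drop0 -sumrN; congr (_ + _).
by apply: eq_bigr => i _; rewrite exprS -scaleNr mulN1r.
Qed.

(** The differential as an inner part and two outer products. *)
Lemma hochschild_dE f s : mlin f ->
  hochschild_d f s = conv ciota f s - ins 2 cmu f s +
                     (-1) ^+ size s *: conv f ciota s.
Proof.
move=> fl; case: s => [|a t].
  by rewrite /= conv_iota_nil mu_ins_nil // conv_iotar_nil scaler0 subr0 addr0.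
rewrite conv_iota_cons mu_insE // -sumrN.
rewrite [conv f ciota _](_ : _ = f (belast a t) * last a t); last first.
  by rewrite lastI conv_iota_rcons.
rewrite /hochschild_d; congr (_ + _ + _); apply: eq_bigr => i _.
by rewrite signS.
Qed.

Lemma mlin_d f : mlin f -> mlin (hochschild_d f).
Proof.
move=> fl; apply: mlin_ext (fun s => esym (hochschild_dE s fl)) _.
apply: mlinD.
  by apply: mlinB; [apply: mlin_conv mlin_iota fl|apply: mlin_ins mlin_mu fl].
apply: (@mlin_size _ _ _ (fun n => (-1) ^+ n) (conv f ciota)).
exact: mlin_conv fl mlin_iota.
Qed.

Lemma hochschild_d_par p f s : mlin f -> par p f ->
  hochschild_d f s = conv ciota f s - ins 2 cmu f s -
                     (-1) ^+ p *: conv f ciota s.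
Proof.
move=> fl fp; rewrite hochschild_dE // -signS.
have [->|e] := par_case s (par_conv fp par_iota); first by rewrite !scaler0.
by congr (_ + _); sgn.
Qed.

End Differential.

Arguments cone {k A} s.
Arguments ciota {k A} s.
Arguments cmu {k A} s.

(** * The Gerstenhaber bracket *)

Section Gerstenhaber.
Variables (k : comPzRingType) (A : algebra k).
Implicit Types (V W : lmodType k) (s t u v w x y z : seq A) (a b : A).
Implicit Types (f g h : seq A -> A) (p q r : nat).

(** Cocycles of parity [p], without condition on their support. *)
Record par_cocycle p f : Prop := ParCocycle {
  par_cocycle_mlin : mlin f;
  par_cocycle_par : par p f;
  par_cocycle_d : hochschild_d f =1 (fun=> 0)
}.

Lemma par_cocycle_mu p f s : par_cocycle p f ->
  ins 2 (@cmu _ A) f s =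
  conv (@ciota _ A) f s - (-1) ^+ p *: conv f (@ciota _ A) s.
Proof.
case=> fl fp df; have := df s; rewrite (hochschild_d_par s fl fp).
by move/eqP; rewrite addrAC subr_eq0 => /eqP ->.
Qed.

(** The differential is a graded derivation of the product. *)
Lemma d_conv p f g s : mlin f -> mlin g -> par p f ->
  hochschild_d (conv f g) s =
  conv (hochschild_d f) g s + (-1) ^+ p *: conv f (hochschild_d g) s.
Proof.
move=> fl gl fp; rewrite hochschild_dE; last exact: mlin_conv.
rewrite (ins_conv _ _ fp (@par_mu _ A) fl).
rewrite (eq_conv (fun t => hochschild_d_par t fl fp) (frefl g)).
rewrite (eq_conv (frefl f) (fun t => hochschild_dE t gl)).
rewrite !convBl convDr convBr convZl -!convA.
have -> : conv f (fun t => (-1) ^+ size t *: conv g (@ciota _ A) t) s =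
    (-1) ^+ p *: ((-1) ^+ size s *: conv f (conv g (@ciota _ A)) s).
  rewrite !cutZ; apply: eq_cut => u v ->.
  rewrite -alg_scalerAr; have [->|fu] := par_case u fp.
    by rewrite !mul0r !scaler0.
  by sgn.
rewrite !(convA f (@ciota _ A)) !(convA f g).
signed_abel.
Qed.

(** A cocycle acts by a coderivation that commutes with the inner part of the
    differential. *)
Lemma ins_mu_comm V p f (G : seq A -> V) s : par_cocycle p f -> mlin G ->
  ins 2 (@cmu _ A) (ins p f G) s = (-1) ^+ p.+1 *: ins p f (ins 2 (@cmu _ A) G)
    s.
Proof.
move=> fc Gl; have [fl fp _] := fc.
have /eqP := ins_commutator s fp (@par_mu _ A) fl (@mlin_mu _ A) Gl.
rewrite subr_eq => /eqP ->.
have -> : ins p f (@cmu _ A) =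
    fun t => (-1) ^+ p.+1 *: ins 2 (@cmu _ A) f t + 0.
  apply/funext => t; rewrite ins_mu // (par_cocycle_mu _ fc).
  signed_abel.
rewrite (ins_comb _ _ (fun=> 0) _ _ Gl) ins0f //.
signed_abel.
Qed.

(** The cup product is commutative up to homotopy. *)
Lemma d_ins p q f g s : par_cocycle p f -> par_cocycle q g ->
  hochschild_d (ins p f g) s =
  (-1) ^+ p *: (conv f g s - (-1) ^+ (p * q) *: conv g f s).
Proof.
move=> fc gc; have [[fl fp _] [gl gq _]] := (fc, gc).
rewrite (hochschild_d_par (p := (p + q).+1)); last 2 first.
- exact: mlin_ins.
- exact: par_ins.
rewrite ins_mu_comm // (eq_ins _ _ _ (fun t => par_cocycle_mu t gc)) insB insZ.
rewrite (ins_conv _ _ (@par_iota _ A) fp (@mlin_iota _ A)).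
rewrite (ins_conv _ _ gq fp gl).
rewrite (eq_conv (@ins_iota _ _ p f) (frefl g)).
rewrite (eq_conv (frefl g) (@ins_iota _ _ p f)).
rewrite mul1n; signed_abel.
Qed.

(** The Gerstenhaber bracket of cochains of degrees [p] and [q]. *)
Definition bracket p q f g s : A :=
  ins q g f s - (-1) ^+ (p.+1 * q.+1) *: ins p f g s.

Lemma mlin_bracket p q f g : mlin f -> mlin g -> mlin (bracket p q f g).
Proof.
by move=> fl gl; apply: mlinB; [|apply: mlinZ]; apply: mlin_ins.
Qed.

Lemma par_bracket p q f g : mlin f -> mlin g -> par p f -> par q g ->
  par (p + q).+1 (bracket p q f g).
Proof.
move=> fl gl fp gq s Ns.
rewrite /bracket (par_ins fp gq) // (par_ins gq fp) ?scaler0 ?subr0 //.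
by rewrite addnC.
Qed.

Lemma par_cocycle_bracket p q f g : par_cocycle p f -> par_cocycle q g ->
  par_cocycle (p + q).+1 (bracket p q f g).
Proof.
move=> fc gc; have [[fl fp _] [gl gq _]] := (fc, gc).
split; [exact: mlin_bracket|exact: par_bracket|move=> s].
have -> : bracket p q f g =
    - ((-1) ^+ (p.+1 * q.+1)) *: ins p f g + ins q g f.
  by apply/funext => t; rewrite /bracket !fctE scaleNr addrC.
rewrite hochschild_d_linear !fctE !(d_ins s gc fc, d_ins s fc gc) scaleNr.
signed_abel.
Qed.

Lemma ins_bracket V p q f g (G : seq A -> V) s :
  par p f -> par q g -> mlin f -> mlin g -> mlin G ->
  ins (p + q).+1 (bracket p q f g) G s =
  ins q g (ins p f G) s - (-1) ^+ (p.+1 * q.+1) *: ins p f (ins q g G) s.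
Proof.
move=> fp gq fl gl Gl; rewrite ins_commutator //.
have -> : bracket p q f g = fun t =>
    - ((-1) ^+ (p.+1 * q.+1)) *: ins p f g t + ins q g f t.
  by apply/funext => t; rewrite /bracket scaleNr addrC.
by rewrite ins_comb // scaleNr addrC.
Qed.

Lemma bracket_jacobi p q r f g h s :
  par p f -> par q g -> par r h -> mlin f -> mlin g -> mlin h ->
  bracket p (q + r).+1 f (bracket q r g h) s =
  bracket (p + q).+1 r (bracket p q f g) h s +
  (-1) ^+ (p.+1 * q.+1) *: bracket q (p + r).+1 g (bracket p r f h) s.
Proof.
move=> fp gq hr fl gl hl.
rewrite {1 3 5}/bracket !ins_bracket // /bracket !insB !insZ.
signed_abel.
Qed.

End Gerstenhaber.

(** * The Leibniz rule *)

Section Leibniz.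
Variables (k : comPzRingType) (A : algebra k).
Implicit Types (V W : lmodType k) (r s t u v w x y z : seq A) (a b : A).
Implicit Types (f g h : seq A -> A) (p q m n : nat).

(** An insertion in [x ++ a :: z] takes place before [a], after [a], or
    absorbs [a]. *)
Lemma ins_cat_cons V p f (G : seq A -> V) x a z :
  ins p f G (x ++ a :: z) =
  ins p f (fun t => G (t ++ a :: z)) x +
  (-1) ^+ ((size x).+1 * p.+1) *: ins p f (fun t => G (x ++ a :: t)) z +
  cut x (fun x1 x2 => cut z (fun z1 z2 =>
    (-1) ^+ (size x1 * p.+1) *: G (x1 ++ f (x2 ++ a :: z1) :: z2))).
Proof.
rewrite {1}/ins cut_cat_cons addrAC; congr (_ + _).
  rewrite -cutD; apply: eq_cut => u x' _; rewrite cut_cat_cons; congr (_ + _).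
  by apply: eq_cut => v w _; rewrite -catA.
rewrite cutZ; apply: eq_cut => u r _; rewrite cutZ; apply: eq_cut => v w _.
by rewrite -catA; sgn.
Qed.

Lemma ins_ins_exchange V p f q g (P : seq A -> seq A -> V) s t :
  ins p f (fun u => ins q g (P u) t) s = ins q g (fun v => ins p f (P^~ v) s) t.
Proof.
rewrite /ins.
transitivity (cut s (fun u r => cut t (fun u' r' => cut r (fun v w => cut r'
  (fun v' w' =>
   (-1) ^+ (size u * p.+1) *: ((-1) ^+ (size u' * q.+1) *:
      P (u ++ f v :: w) (u' ++ g v' :: w'))))))).
  apply: eq_cut => u r _; rewrite -cut_exchange; apply: eq_cut => v w _.
  by rewrite cutZ; apply: eq_cut => u' r' _; rewrite cutZ.
rewrite cut_exchange; apply: eq_cut => u' r' _.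
transitivity (cut s (fun u r => cut r' (fun v' w' => cut r (fun v w =>
   (-1) ^+ (size u * p.+1) *: ((-1) ^+ (size u' * q.+1) *:
      P (u ++ f v :: w) (u' ++ g v' :: w')))))).
  by apply: eq_cut => u r _; rewrite cut_exchange.
rewrite cut_exchange; apply: eq_cut => v' w' _; rewrite cutZ.
by apply: eq_cut => u r _; rewrite cutZ; apply: eq_cut => v w _; sgn.
Qed.

Lemma mlin_ins2 V p f q g (G : seq A -> V) :
  mlin f -> mlin g -> mlin G -> mlin (ins2 p f q g G).
Proof.
move=> fl gl Gl; apply: mlin_cut => [r|u].
  apply: mlin_sum => v w.
  apply: (@mlin_size _ _ _ (fun n => (-1) ^+ (n * q.+1))
            (fun u => ins p f (fun u => G (u ++ g v :: w)) u)).
  by apply: mlin_ins => //; apply: mlin_tail.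
apply: mlin_cut => [w|v]; apply: mlinZ => s t c x y.
  rewrite -insZ -insD; apply: eq_ins => u'.
  exact: (mlin_slot _ _ Gl gl).
rewrite -insZ -insD; apply: eq_ins => u'.
have := mlin_head (rcons u' (g v)) Gl.
by move=> /(_ s t c x y); rewrite !cat_rcons.
Qed.

Lemma supp_ins2 V p f q g (G : seq A -> V) M N K :
  supp M f -> supp N g -> supp K G -> mlin G ->
  supp (M + N + K) (ins2 p f q g G).
Proof.
move=> fM gN GK Gl s Ns; apply: cut_zero => u r es; apply: cut_zero => v w er.
case: (leqP N (size v)) => [/gN ->|lt_v].
  by rewrite ins_eq0 ?scaler0 // => t; rewrite slot0.
case: (leqP K (size w)) => [le_w|lt_w].
  by rewrite ins_eq0 ?scaler0 // => t; rewrite GK // size_cat /=; lia.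
have GKw : supp (K - size w) (fun t => G (t ++ g v :: w)).
  by move=> t Nt; apply: GK; rewrite size_cat /=; lia.
rewrite (supp_ins p fM GKw) ?scaler0 //; first exact: mlin_tail.
move: Ns lt_v lt_w; rewrite es er !size_cat; lia.
Qed.

Lemma par_ins2 V p f q g n (G : seq A -> V) :
  par p f -> par q g -> par n G -> mlin G -> par (p + q + n) (ins2 p f q g G).
Proof.
move=> fp gq Gn Gl s Ns; apply: cut_zero => u r es; apply: cut_zero => v w er.
have [gv0|gv] := par_case v gq.
  by rewrite ins_eq0 ?scaler0 // => t; rewrite gv0 slot0.
have Gnw : par (n + size w).+1 (fun t => G (t ++ g v :: w)).
  move=> t Nt; apply: Gn; apply: contra Nt => /eqP; rewrite size_cat /= => e.
  by apply/eqP; parity.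
rewrite (par_ins fp Gnw) ?scaler0 //; first exact: mlin_tail.
apply: contra Ns => /eqP; rewrite es er => e; apply/eqP; parity.
Qed.

(** The compatibility of [ins m c] with simultaneous insertions of elements
    [f] and [g] that commute with [c]. *)
Lemma ins_ins2 V p f q g m c (G : seq A -> V) s :
  par p f -> par q g -> par m c -> mlin f -> mlin g -> mlin c -> mlin G ->
  (forall (H : seq A -> V) t, mlin H -> ins m c (ins p f H) t =
     (-1) ^+ (p.+1 * m.+1) *: ins p f (ins m c H) t) ->
  (forall t, ins m c g t = (-1) ^+ (q.+1 * m.+1) *: ins q g c t) ->
  ins m c (ins2 p f q g G) s =
  (-1) ^+ ((p + q) * m.+1) *:
    (ins2 p f q g (ins m c G) s - ins (p + q + m) (ins2 p f q g c) G s).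
Proof.
move=> fp gq cm fl gl cl Gl fc gc.
have Gt y z : mlin (fun t => G (t ++ g y :: z)) by apply: mlin_tail.
(* The terms where [c] acts before, inside and after the value of [g]. *)
pose S1 x y z := (-1) ^+ ((size x + m).+1 * q.+1 + p.+1 * m.+1) *:
  ins p f (ins m c (fun t => G (t ++ g y :: z))) x.
pose S2 x y z := (-1) ^+ (size x * (q + m) + q.+1 * m.+1) *:
  ins p f (fun t => G (t ++ ins q g c y :: z)) x.
pose S3 x y z := (-1) ^+ (size x * q.+1 + (size x + q) * m.+1) *:
  ins p f (fun t => ins m c (fun t' => G (t ++ g y :: t')) z) x.
have -> : ins m c (ins2 p f q g G) s =
    cut s (fun x r => cut r (fun y z => S1 x y z + S2 x y z + S3 x y z)).
  rewrite /ins2 ins_cut; apply: eq_cut => x r es.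
  rewrite ins_sum ins_cut cutZ -cutD; apply: eq_cut => y z er.
  rewrite ins_size //; last exact: mlin_ins.
  have -> : ins m c (fun v => (-1) ^+ (size x * q.+1) *:
      ins p f (fun u => G (u ++ g v :: z)) x) y =
    (-1) ^+ (size x * q.+1 + q.+1 * m.+1) *:
      ins p f (fun t => G (t ++ ins q g c y :: z)) x.
    rewrite insZ -(ins_ins_exchange p f m c (fun u v => G (u ++ g v :: z))).
    rewrite exprD -scalerA -(insZ _ _ _ (_ ^+ (q.+1 * _))); congr (_ *: _).
    by apply: eq_ins => t; rewrite ins_slot // gc slotZ.
  have -> : ins m c (fun w => (-1) ^+ (size x * q.+1) *:
      ins p f (fun u => G (u ++ g y :: w)) x) z =
    (-1) ^+ (size x * q.+1) *:
      ins p f (fun t => ins m c (fun t' => G (t ++ g y :: t')) z) x.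
    by rewrite insZ -(ins_ins_exchange p f m c (fun u w => G (u ++ g y :: w))).
  rewrite fc // !scalerDr addrA; congr (_ + _ + _); rewrite /S1 /S2 /S3.
  - by sgn.
  - by sgn.
  - have [gy0|gy] := par_case y gq; last by sgn.
    rewrite (@ins_eq0 _ _ _ _ _ (fun t => ins m c _ z)) ?scaler0 // => t.
    by apply: ins_eq0 => t'; rewrite gy0 slot0.
have -> : ins2 p f q g (ins m c G) s =
    (-1) ^+ ((p + q) * m.+1) *:
      cut s (fun x r => cut r (fun y z => S1 x y z + S2 x y z + S3 x y z)) +
    ins (p + q + m) (ins2 p f q g c) G s.
  rewrite /ins2.
  transitivity (cut s (fun x r => cut r (fun y z =>
    (-1) ^+ ((p + q) * m.+1) *: (S1 x y z + S3 x y z))) +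
    cut s (fun x r => cut r (fun y z => (-1) ^+ (size x * q.+1) *:
    ins p f (fun t => cut t (fun x1 x2 => cut z (fun z1 z2 =>
    (-1) ^+ (size x1 * m.+1) *: G (x1 ++ c (x2 ++ g y :: z1) :: z2)))) x))).
    rewrite -cutD; apply: eq_cut => x r es; rewrite -cutD.
    apply: eq_cut => y z er.
    rewrite (eq_ins _ _ _ (fun t => ins_cat_cons _ _ _ t _ _)) !insD !scalerDr.
    congr (_ + _ + _).
      by rewrite /S1; sgn.
    rewrite (@eq_ins k A V p f _ (fun t => (-1) ^+ (size t * m.+1) *: ((-1) ^+
      m.+1 *:
      ins m c (fun t' => G (t ++ g y :: t')) z))); last by move=> t; sgn.
    rewrite ins_size // ?insZ /S3; first by sgn.
    apply: mlinZ; apply: mlin_ins_param => t; exact: mlin_tail.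
  under [in X in _ + X]eq_cut => x r _.
    under eq_cut => y z _ do rewrite ins_cut cutZ.
    over.
  transitivity (cut s (fun x r => cut r (fun y z =>
    (-1) ^+ ((p + q) * m.+1) *: (S1 x y z + S3 x y z))) +
    cut s (fun x r => cut r (fun y z => cut x (fun x1 x2 => cut z (fun z1 z2 =>
     (-1) ^+ ((size x1 + size x2) * q.+1 + (size x1 + p).+1 * m.+1) *:
       ins p f (fun t => G (t ++ c (x2 ++ g y :: z1) :: z2)) x1 +
     (-1) ^+ ((size x1 + size x2) * q.+1 + size x1 * (p + m)) *:
       G (x1 ++ ins p f (fun t => c (t ++ g y :: z1)) x2 :: z2)))))).
    congr (_ + _); apply: eq_cut => x r es; apply: eq_cut => y z er.
    apply: eq_cut => x1 x2 ex; rewrite !ins_sum cutZ -cutD cutZ.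
    apply: eq_cut => z1 z2 ez; rewrite ins_size //; last exact: mlin_tail.
    rewrite insZ ins_slot // scalerDr ex.
    by congr (_ + _); sgn.
  rewrite cut5.
  have -> : (-1) ^+ ((p + q) * m.+1) *:
      cut s (fun x r => cut r (fun y z => S1 x y z + S2 x y z + S3 x y z)) =
    cut s (fun x r => cut r (fun y z =>
      (-1) ^+ ((p + q) * m.+1) *: (S1 x y z + S3 x y z))) +
    cut s (fun x r => cut r (fun y z => (-1) ^+ ((p + q) * m.+1) *: S2 x y z)).
    rewrite cutZ -cutD; apply: eq_cut => x r _; rewrite cutZ -cutD.
    by apply: eq_cut => y z _; rewrite -scalerDr addrAC.
  rewrite -addrA; congr (_ + _); rewrite -cutD; apply: eq_cut => x r _.
  rewrite -cutD; apply: eq_cut => y' z _.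
  rewrite /S2.
  rewrite (@eq_ins k A V p f _ (fun t => cut y' (fun x2 r' => cut r'
    (fun y z1 => (-1) ^+ (size x2 * q.+1) *:
       G (t ++ c (x2 ++ g y :: z1) :: z))))); last first.
    move=> t; rewrite slot_cut //; apply: eq_cut => x2 r' _.
    by rewrite slot_cut //; apply: eq_cut => y z1 _; rewrite slotZ.
  rewrite ins_sum slot_cut // scalerA [in RHS]cutZ [X in _ + X]cutZ -cutD.
  apply: eq_cut => x2 r' _.
  rewrite ins_sum slot_cut // [in RHS]cutZ [X in _ + X]cutZ -cutD.
  apply: eq_cut => y z1 _.
  by rewrite insZ slotZ //; congr (_ + _); sgn.
by rewrite addrK; signed_abel.
Qed.

Lemma ins2B V p f q g (G H : seq A -> V) c s :
  ins2 p f q g (fun t => G t - c *: H t) s =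
  ins2 p f q g G s - c *: ins2 p f q g H s.
Proof.
rewrite cutZ -cutB; apply: eq_cut => x r _.
rewrite cutZ -cutB; apply: eq_cut => y z _.
by rewrite insB insZ scalerBr !scalerA mulrC.
Qed.

Lemma eq_ins2 V p f q g (G H : seq A -> V) s :
  G =1 H -> ins2 p f q g G s = ins2 p f q g H s.
Proof.
move=> e; apply: eq_cut => x r _; apply: eq_cut => y z _.
by congr (_ *: _); apply: eq_ins => t; rewrite e.
Qed.

(** [ins2] on a product. *)
Lemma ins2_conv p f q g n h h' s :
  par p f -> par q g -> par n h -> mlin f -> mlin g -> mlin h ->
  ins2 p f q g (conv h h') s =
  conv (ins2 p f q g h) h' s +
  (-1) ^+ ((n + p).+1 * q.+1) *: conv (ins p f h) (ins q g h') s +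
  (-1) ^+ (n * (p + q)) *: conv h (ins2 p f q g h') s.
Proof.
move=> fp gq hn fl gl hl.
have E x a z : ins p f (fun t => conv h h' (t ++ a :: z)) x =
    conv (ins p f h) (fun t => h' (t ++ a :: z)) x +
    (-1) ^+ (n * p.+1) *: conv h (ins p f (fun t => h' (t ++ a :: z))) x +
    cut z (fun z1 z2 => ins p f (fun t => h (t ++ a :: z1)) x * h' z2).
  rewrite -(ins_conv _ _ hn fp hl) /conv.
  rewrite (eq_ins _ _ _ (fun t => cut_cat_cons _ _ _ _)) insD ins_sum.
  congr (_ + _); apply: eq_cut => z1 z2 _.
  by rewrite (ins_comp _ _ (L := fun a : A => a * h' z2)) // => b a1 a2;
    rewrite mulrDl -alg_scalerAl.
rewrite /ins2.
transitivity (cut s (fun x r => cut r (fun y z => cut z (fun z1 z2 =>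
    (-1) ^+ (size x * q.+1) *: ins p f (fun t => h (t ++ g y :: z1)) x * h'
      z2)))
  + cut s (fun x r => cut r (fun y z => cut x (fun x1 x2 =>
    (-1) ^+ (size x * q.+1) *: (ins p f h x1 * h' (x2 ++ g y :: z)))))
  + cut s (fun x r => cut r (fun y z => cut x (fun x1 x2 =>
    (-1) ^+ (size x * q.+1 + n * p.+1) *:
      (h x1 * ins p f (fun t => h' (t ++ g y :: z)) x2))))).
  rewrite -!cutD; apply: eq_cut => x r _; rewrite -!cutD.
  apply: eq_cut => y z _; rewrite E !scalerDr addrC addrA.
  congr (_ + _ + _).
  - by rewrite cutZ; apply: eq_cut => u v _; rewrite alg_scalerAl.
  - by rewrite cutZ.
  - by rewrite !cutZ; apply: eq_cut => u v _; sgn.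
congr (_ + _ + _).
- rewrite /conv.
  transitivity (cut s (fun x r => cut r (fun r' z2 => cut r' (fun y z1 =>
    (-1) ^+ (size x * q.+1) *: ins p f (fun t => h (t ++ g y :: z1)) x * h'
      z2)))).
    by apply: eq_cut => x r _; rewrite cutA.
  rewrite cutA; apply: eq_cut => x z2 _.
  rewrite (cut_raddf (f := fun a : A => a * h' z2)) => [|a b]; last first.
    exact: mulrDl.
  apply: eq_cut => u r _.
  rewrite (cut_raddf (f := fun a : A => a * h' z2)) => [|a b]; last first.
    exact: mulrDl.
  by apply: eq_cut.
- transitivity (cut s (fun x r => cut x (fun x1 x2 => cut r (fun y z =>
    (-1) ^+ (size (x1 ++ x2) * q.+1) *:
      (ins p f h x1 * h' (x2 ++ g y :: z)))))).
    apply: eq_cut => x r _; rewrite cut_exchange.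
    by apply: eq_cut => x1 x2 ->.
  rewrite -cutA /conv cutZ; apply: eq_cut => x1 r es.
  have [->|hx] := par_case x1 (par_ins fp hn hl).
    rewrite mul0r scaler0; apply: cut_zero => u v _; apply: cut_zero => *.
    by rewrite mul0r scaler0.
  rewrite [ins q g h' r]/ins.
  rewrite (cut_raddf (f := *%R (ins p f h x1))); last exact: mulrDr.
  rewrite cutZ; apply: eq_cut => x2 w er.
  rewrite (cut_raddf (f := *%R (ins p f h x1))); last exact: mulrDr.
  rewrite cutZ; apply: eq_cut => y z _.
  by rewrite -alg_scalerAr; sgn.
- transitivity (cut s (fun x r => cut x (fun x1 x2 => cut r (fun y z =>
    (-1) ^+ (size (x1 ++ x2) * q.+1 + n * p.+1) *:
      (h x1 * ins p f (fun t => h' (t ++ g y :: z)) x2))))).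
    apply: eq_cut => x r _; rewrite cut_exchange.
    by apply: eq_cut => x1 x2 ->.
  rewrite -cutA /conv cutZ; apply: eq_cut => x1 r es.
  have [->|hx] := par_case x1 hn.
    rewrite mul0r scaler0; apply: cut_zero => u v _; apply: cut_zero => *.
    by rewrite mul0r scaler0.
  rewrite (cut_raddf (f := *%R (h x1))); last exact: mulrDr.
  rewrite cutZ; apply: eq_cut => x2 w er.
  rewrite (cut_raddf (f := *%R (h x1))); last exact: mulrDr.
  rewrite cutZ; apply: eq_cut => y z _.
  by rewrite -alg_scalerAr; sgn.
Qed.

Lemma ins2_iota p f q g s : ins2 p f q g (@ciota _ A) s = 0.
Proof.
apply: cut_zero => u r _; apply: cut_zero => v w _.
rewrite (@eq_ins _ _ _ p f _ (fun t => cone t * ciota (g v :: w))) => [|[|a t]].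
- rewrite (ins_comp _ _ (L := fun a : A => a * _)) => [|c a b]; last first.
    by rewrite mulrDl -alg_scalerAl.
  by rewrite ins_one mul0r scaler0.
- by rewrite mul1r.
- by rewrite mul0r; case: t.
Qed.

Lemma ins2_mu p f q g s : par p f -> par q g -> mlin f -> mlin g ->
  ins2 p f q g (@cmu _ A) s = (-1) ^+ (p * q.+1) *: conv f g s.
Proof.
move=> fp gq fl gl.
rewrite (ins2_conv _ _ fp gq (@par_iota _ A) fl gl (@mlin_iota _ A)).
rewrite (eq_conv (@ins2_iota p f q g) (frefl _)).
rewrite (eq_conv (frefl _) (@ins2_iota p f q g)).
rewrite (eq_conv (@ins_iota _ _ p f) (@ins_iota _ _ q g)).
rewrite [conv (fun=> 0) _ s]cut_zero => [|*]; last by rewrite mul0r.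
rewrite [conv _ (fun=> 0) s]cut_zero => [|*]; last by rewrite mulr0.
by rewrite scaler0 addr0 add0r; sgn.
Qed.

(** The cocycle equation, as a vanishing bracket with the multiplication. *)
Lemma par_cocycle_ins_mu q g s : par_cocycle q g ->
  ins 2 (@cmu _ A) g s = (-1) ^+ q.+1 *: ins q g (@cmu _ A) s.
Proof.
move=> gc; rewrite (par_cocycle_mu _ gc) ins_mu; last exact: par_cocycle_par gc.
signed_abel.
Qed.

(** The homotopy for the Leibniz rule. *)
Lemma d_ins2 p q n f g h s : par_cocycle p f -> par_cocycle q g -> par_cocycle
  n h ->
  hochschild_d (ins2 p f q g h) s =
  (-1) ^+ (q + p * q) *: (ins (p + q) (conv f g) h s - conv f (ins q g h) s -
    (-1) ^+ (n.+1 * q) *: conv (ins p f h) g s).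
Proof.
move=> fc gc hc; have [[[fl fp _] [gl gq _]] [hl hn _]] := (fc, gc, hc).
rewrite (hochschild_d_par (p := p + q + n)); last 2 first.
- exact: mlin_ins2.
- exact: par_ins2.
have fmu (H : seq A -> A) t : mlin H -> ins 2 (@cmu _ A) (ins p f H) t =
    (-1) ^+ (p.+1 * 3) *: ins p f (ins 2 (@cmu _ A) H) t.
  by move=> Hl; rewrite (ins_mu_comm _ fc) //; sgn.
have gmu t : ins 2 (@cmu _ A) g t = (-1) ^+ (q.+1 * 3) *: ins q g (@cmu _ A) t.
  by rewrite (par_cocycle_ins_mu _ gc); sgn.
rewrite (ins_ins2 _ fp gq (@par_mu _ A) fl gl (@mlin_mu _ A) hl fmu gmu).
rewrite (eq_ins2 _ _ _ _ _ (fun t => par_cocycle_mu t hc)) ins2B.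
have -> : ins (p + q + 2) (ins2 p f q g (@cmu _ A)) h s =
    (-1) ^+ (p * q.+1) *: ins (p + q) (conv f g) h s.
  rewrite -insZf // (@ins_odd _ _ _ _ (p + q)); last by parity.
  by congr (ins _ _ h s); apply/funext => t; rewrite ins2_mu.
rewrite (ins2_conv _ _ fp gq (@par_iota _ A) fl gl (@mlin_iota _ A)).
rewrite (ins2_conv _ _ fp gq hn fl gl hl).
rewrite (eq_conv (@ins2_iota p f q g) (frefl _)).
rewrite (eq_conv (frefl _) (@ins2_iota p f q g)).
rewrite (eq_conv (@ins_iota _ _ p f) (frefl _)).
rewrite (eq_conv (frefl _) (@ins_iota _ _ q g)).
rewrite [conv (fun=> 0) _ s]cut_zero => [|*]; last by rewrite mul0r.
rewrite [conv _ (fun=> 0) s]cut_zero => [|*]; last by rewrite mulr0.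
signed_abel.
Qed.

(** The Leibniz rule up to homotopy. *)
Lemma bracket_conv p q n f g h s : par_cocycle p f -> par_cocycle q g ->
  par_cocycle n h ->
  bracket n (p + q) h (conv f g) s =
  conv f (bracket n q h g) s + (-1) ^+ (n.+1 * q) *: conv (bracket n p h f) g s
    +
  (-1) ^+ (q + p * q) *: hochschild_d (ins2 p f q g h) s.
Proof.
move=> fc gc hc; have [[[fl fp _] [gl gq _]] [hl hn _]] := (fc, gc, hc).
rewrite (d_ins2 _ fc gc hc) /bracket (ins_conv _ _ fp hn fl) convBr convBl
  convZr convZl.
signed_abel.
Qed.

End Leibniz.

(** * Cyclic sums *)

Section Rotation.
Variables (k : comPzRingType) (A : algebra k).
Implicit Types (V W : lmodType k) (r s t u v w x y z : seq A) (a b : A).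
Implicit Types (f g h : seq A -> A) (p q m n c : nat).

Lemma iota_cat s a t : ciota (s ++ a :: t) = cone s * (a * cone t).
Proof. by case: s => [|b [|b' s]]; rewrite /= ?mul0r // mul1r; case: t => [|c
  t]; rewrite ?mulr1 ?mulr0. Qed.

Lemma conv_cat f g y a x :
  conv f g (y ++ a :: x) = conv f (fun z => g (z ++ a :: x)) y +
                           conv (fun z => f (y ++ a :: z)) g x.
Proof. exact: cut_cat_cons. Qed.

Lemma mu_cat s a t :
  cmu (s ++ a :: t) = cone s * (a * ciota t) + ciota s * a * cone t.
Proof.
rewrite /cmu conv_cat addrC.
rewrite (eq_conv (f := fun z => ciota (s ++ a :: z)) (fun z => iota_cat s a z)
  (frefl ciota)).
rewrite (eq_conv (frefl ciota) (fun z => iota_cat z a t)).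
congr (_ + _); rewrite /conv.
  rewrite cut_l0 => [|b u v]; first by rewrite /= mulr1 mulrA.
  by rewrite !mulr0 mul0r.
rewrite cut_r0 => [|u b v]; first by rewrite /= mul1r mulrA.
by rewrite mul0r mulr0.
Qed.

(** The Hochschild differential with coefficients in the dual of [A], for
    functions of a first argument and a list. *)
Definition cyc_d V (F : A -> seq A -> V) a t : V :=
  cut t (fun e r => F (a * ciota e) r) - ins 2 (@cmu _ A) (F a) t +
  (-1) ^+ size t *: cut t (fun r e => F (ciota e * a) r).

(** The operators [T] below are the identity and the coderivations of
    cocycles, of respective shifted degree [c]. *)
Record cyc_op V c (T : (seq A -> V) -> seq A -> V) : Prop := CycOp {
  cyc_op_ext : forall G H s, G =1 H -> T G s = T H s;
  cyc_op_lin : forall (b : k) G H s,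
    T (fun t => b *: G t + H t) s = b *: T G s + T H s;
  cyc_op_mlin : forall G, mlin G -> mlin (T G);
  cyc_op_size : forall G s, mlin G ->
    T (fun t => (-1) ^+ size t *: G t) s = (-1) ^+ (size s + c) *: T G s;
  cyc_op_mu : forall G s, mlin G ->
    ins 2 (@cmu _ A) (T G) s = (-1) ^+ c *: T (ins 2 (@cmu _ A) G) s;
  cyc_op_exchange : forall (P : seq A -> seq A -> V) s t,
    ins 2 (@cmu _ A) (fun v => T (P^~ v) s) t =
    T (fun u => ins 2 (@cmu _ A) (P u) t) s
}.

Lemma cyc_op_id V : cyc_op 0 (@id (seq A -> V)).
Proof.
split=> //.
- by move=> G s Gl; rewrite addn0.
- by move=> G s Gl; rewrite scale1r.
Qed.

Lemma cyc_op_ins V p f : par_cocycle p f -> cyc_op p.+1 (@ins _ _ V p f).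
Proof.
move=> fc; have [fl fp _] := fc; split.
- by move=> G H s; apply: eq_ins.
- by move=> b G H s; rewrite insD insZ.
- by move=> G; apply: mlin_ins.
- move=> G s Gl; have := ins_size 1 s fp Gl; rewrite !muln1 addnS => <-.
  by apply: eq_ins => t; rewrite muln1.
- by move=> G s Gl; rewrite (ins_mu_comm _ fc).
- by move=> P s t; rewrite ins_ins_exchange.
Qed.

(** Sum over the cyclic rotations of [a :: t]; [T] acts on the letters
    preceding [a] after the rotation. *)
Definition cycsum V (T : (seq A -> V) -> seq A -> V) (K : seq A -> V) a t : V :=
  cut t (fun x y => (-1) ^+ ((size x).+1 * size y) *:
    T (fun z => K (z ++ a :: x)) y).

Section CycOp.
Variables (V : lmodType k) (c : nat) (T : (seq A -> V) -> seq A -> V).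
Hypothesis Top : cyc_op c T.

Lemma cyc_opD G H s : T (fun t => G t + H t) s = T G s + T H s.
Proof.
rewrite -[T G s]scale1r -(cyc_op_lin Top); apply: (cyc_op_ext Top) => t.
by rewrite scale1r.
Qed.

Lemma cyc_op0 s : T (fun=> 0) s = 0.
Proof.
transitivity (T (fun t => -1 *: 0 + 0) s).
  by apply: (cyc_op_ext Top) => t; rewrite scaler0 addr0.
by rewrite (cyc_op_lin Top (-1) (fun=> 0) (fun=> 0)) scaleN1r addNr.
Qed.

Lemma cyc_opZ (b : k) G s : T (fun t => b *: G t) s = b *: T G s.
Proof.
have := cyc_op_lin Top b G (fun=> 0) s; rewrite cyc_op0 addr0 => <-.
by apply: (cyc_op_ext Top) => t; rewrite addr0.
Qed.

Lemma cyc_opN G s : T (fun t => - G t) s = - T G s.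
Proof.
by rewrite -scaleN1r -cyc_opZ; apply: (cyc_op_ext Top) => t; rewrite scaleN1r.
Qed.

Lemma cyc_op_sum s t (P : seq A -> seq A -> seq A -> V) :
  T (fun u => cut t (P u)) s = cut t (fun v w => T (fun u => P u v w) s).
Proof. by elim: t P => [|a t IHt] P //=; rewrite cyc_opD IHt. Qed.

Lemma mlin_cyc_op_param s (P : seq A -> seq A -> V) :
  (forall t, mlin (P t)) -> mlin (fun u => T (P^~ u) s).
Proof.
move=> Pl u v b x y; rewrite -(cyc_op_lin Top); apply: (cyc_op_ext Top) => t.
exact: (Pl t).
Qed.

Lemma mlin_cons_head (K : seq A -> V) z a :
  mlin K -> mlin (fun x => K (z ++ a :: x)).
Proof.
move=> Kl; apply: mlin_ext (mlin_head (rcons z a) Kl) => x.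
by rewrite cat_rcons.
Qed.

Lemma mlin_cycsum K a : mlin K -> mlin (cycsum T K a).
Proof.
move=> Kl; apply: mlin_cut => [y|x].
  apply: (@mlin_size _ _ _ (fun n => (-1) ^+ (n.+1 * size y))
            (fun x => T (fun z => K (z ++ a :: x)) y)).
  by apply: mlin_cyc_op_param => t; apply: mlin_cons_head.
apply: (@mlin_size _ _ _ (fun n => (-1) ^+ ((size x).+1 * n))
            (T (fun z => K (z ++ a :: x)))).
exact/(cyc_op_mlin Top)/mlin_tail.
Qed.

Lemma linear_cycsum K t : mlin K -> linear (fun a => cycsum T K a t).
Proof.
move=> Kl b x y; rewrite cutZ -cutD; apply: eq_cut => u v _.
rewrite scalerA mulrC -scalerA -scalerDr -(cyc_op_lin Top); congr (_ *: _).
by apply: (cyc_op_ext Top) => z; rewrite Kl.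
Qed.

(** The inner terms of the differential that do not touch [a] assemble into
    the cyclic sum of the inner part of [K].  The product of [a] with the next
    letter is an outer term of [cyc_d] and cancels; what is left are the
    products of [a] with a letter before it, in the form seen by [T] and as
    the other outer term of [cyc_d]. *)
Lemma cyc_d_cycsum K a t : mlin K ->
  cyc_d (cycsum T K) a t =
  (-1) ^+ c *: cycsum T (ins 2 (@cmu _ A) K) a t -
  (-1) ^+ c *: cut t (fun x y => (-1) ^+ ((size x).+1 * size y) *:
    T (fun z => cut z (fun u e => (-1) ^+ size u *:
        K (u ++ ciota e * a :: x))) y) +
  (-1) ^+ size t *: cut t (fun r e => cycsum T K (ciota e * a) r).
Proof.
move=> Kl; rewrite /cyc_d; congr (_ + _).
(* [S1] and [S2] multiply letters before and after [a]; [S3] and [S4] multiply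
   [a] with the letter after it and before it. *)
pose S1 x y := (-1) ^+ ((size x).+1 * size y) *:
  T (ins 2 (@cmu _ A) (fun z => K (z ++ a :: x))) y.
pose S2 x y := (-1) ^+ (size x * size y) *:
  T (fun z => ins 2 (@cmu _ A) (fun x' => K (z ++ a :: x')) x) y.
pose S3 x y := (-1) ^+ (size x * size y) *:
  T (fun z => cut x (fun e x' => K (z ++ a * ciota e :: x'))) y.
pose S4 x y := (-1) ^+ ((size x).+1 * size y) *:
  T (fun z => cut z (fun u e => (-1) ^+ size u *:
    K (u ++ ciota e * a :: x))) y.
have -> : cut t (fun e r => cycsum T K (a * ciota e) r) = cut t S3.
  rewrite /cycsum cutA; apply: eq_cut => x0 y _.
  rewrite /S3 cyc_op_sum cutZ; apply: eq_cut => e x ->.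
  have [->|e1] := par_case e (@par_iota _ A); last by sgn.
  rewrite mulr0 !(@cyc_op_ext _ _ _ Top (fun z => K (z ++ 0 :: x)) (fun=> 0)).
    by rewrite cyc_op0 !scaler0.
  by move=> z; rewrite slot0.
have -> : ins 2 (@cmu _ A) (cycsum T K a) t =
    cut t (fun x y => S2 x y - (-1) ^+ c *: S1 x y).
  rewrite /cycsum ins_cut; apply: eq_cut => x y _.
  have -> : ins 2 cmu (fun u => (-1) ^+ ((size u).+1 * size y) *:
      T (fun z => K (z ++ a :: u)) y) x = S2 x y.
    rewrite (@eq_ins _ _ _ _ _ _ (fun u => (-1) ^+ (size u * size y) *:
      ((-1) ^+ size y *: T (fun z => K (z ++ a :: u)) y))); last first.
      by move=> u; sgn.
    rewrite ins_size; [|exact: par_mu|].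
      rewrite insZ (cyc_op_exchange Top (fun z u => K (z ++ a :: u))) /S2.
      by sgn.
    apply: mlinZ; apply: mlin_cyc_op_param => z; exact: mlin_cons_head.
  congr (_ + _).
  rewrite (@eq_ins _ _ _ _ _ _ (fun v => (-1) ^+ (size v * (size x).+1) *:
      T (fun z => K (z ++ a :: x)) v)); last by move=> v; sgn.
  rewrite ins_size; [|exact: par_mu|exact/(cyc_op_mlin Top)/mlin_tail].
  rewrite (cyc_op_mu Top); last exact: mlin_tail.
  by rewrite -signS /S1; sgn.
have -> : cycsum T (ins 2 cmu K) a t =
    cut t (fun x y => S1 x y - (-1) ^+ c *: S2 x y + (-1) ^+ c *: S3 x y +
                      S4 x y).
  apply: eq_cut => x y _.
  have -> : T (fun z => ins 2 cmu K (z ++ a :: x)) y =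
      T (fun z => ins 2 cmu (fun u => K (u ++ a :: x)) z +
        (- ((-1) ^+ size z *: ins 2 cmu (fun u => K (z ++ a :: u)) x) +
        ((-1) ^+ size z *: cut x (fun e x' => K (z ++ a * ciota e :: x')) +
        cut z (fun u e => (-1) ^+ size u *: K (u ++ ciota e * a :: x))))) y.
    apply: (cyc_op_ext Top) => z; rewrite ins_cat_cons -addrA; congr (_ + (_ +
      _)).
      by rewrite -signS; sgn.
    transitivity (cut z (fun u v => cut x (fun e x' => (-1) ^+ size u *:
        (K (u ++ (cone v * (a * ciota e)) :: x') +
         K (u ++ (ciota v * a * cone e) :: x'))))).
      apply: eq_cut => u v _; apply: eq_cut => e x' _.
      by rewrite mu_cat (slotD _ _ Kl); sgn.
    transitivity (cut z (fun u v => cut x (fun e x' => (-1) ^+ size u *: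
        K (u ++ (cone v * (a * ciota e)) :: x'))) +
      cut z (fun u v => cut x (fun e x' => (-1) ^+ size u *:
        K (u ++ (ciota v * a * cone e) :: x')))).
      rewrite -cutD; apply: eq_cut => u v _; rewrite -cutD.
      by apply: eq_cut => e x' _; rewrite scalerDr.
    congr (_ + _).
      rewrite cut_r0 => [|u b v].
        by rewrite cutZ; apply: eq_cut => e x' _; rewrite /= mul1r.
      by apply: cut_zero => e x' _; rewrite mul0r slot0 // scaler0.
    apply: eq_cut => u v _; rewrite cut_l0 /= ?mulr1 // => b e x'.
    by rewrite mulr0 slot0 // scaler0.
  rewrite !cyc_opD cyc_opN !(cyc_op_size Top); last 2 first.
  - by apply: mlin_sum => e x'; apply: mlin_tail.
  - by apply: mlin_ins_param => u; apply: mlin_tail.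
  rewrite !scalerDr scalerN !addrA; congr (_ + _ + _ + _).
    by rewrite -!signS /S2; sgn.
  by rewrite /S3; sgn.
rewrite !cutZ -!cutB; apply: eq_cut => x y _; rewrite -/(S4 x y).
signed_abel.
Qed.
End CycOp.

(** Cyclic sums commute with the differential. *)
Lemma cyc_d_cycsum_id V (K : seq A -> V) a t : mlin K ->
  cyc_d (cycsum id K) a t = cycsum id (ins 2 cmu K) a t.
Proof.
move=> Kl; rewrite (cyc_d_cycsum (cyc_op_id V)) // expr0 !scale1r -addrA.
rewrite -[RHS]addr0; congr (_ + _); apply/eqP; rewrite addrC subr_eq0;
  apply/eqP.
rewrite /cycsum cutZ.
transitivity (cut t (fun x r => cut r (fun y e =>
  (-1) ^+ (size t + (size x).+1 * size y) *: K (y ++ ciota e * a :: x)))).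
  rewrite cutA; apply: eq_cut => r e _; rewrite cutZ.
  by apply: eq_cut => x y _; sgn.
apply: eq_cut => x r ->; rewrite cutZ; apply: eq_cut => y e ->.
have [->|e1] := par_case e (@par_iota _ A); last by sgn.
by rewrite mul0r slot0 // !scaler0.
Qed.

(** For the insertion of a cocycle the remaining terms differ only by those
    where the value of [f] is multiplied with [a]. *)
Lemma cyc_d_cycsum_ins V p f (K : seq A -> V) a t : par_cocycle p f -> mlin K ->
  cyc_d (cycsum (@ins _ _ V p f) K) a t =
  (-1) ^+ p.+1 *: cycsum (@ins _ _ V p f) (ins 2 cmu K) a t +
  (-1) ^+ p *: cut t (fun w v => (-1) ^+ ((size w).+1 * p) *:
    cycsum id K (f v * a) w).
Proof.
move=> fc Kl; have [fl fp _] := fc.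
rewrite (cyc_d_cycsum (cyc_op_ins V fc)) // -addrA; congr (_ + _).
have -> : cut t (fun x y => (-1) ^+ ((size x).+1 * size y) *:
    ins p f (fun z => cut z (fun u e => (-1) ^+ size u *:
        K (u ++ ciota e * a :: x))) y) =
  cut t (fun x r => cut r (fun y e => (-1) ^+ (size t + p.+1 + (size x).+1 *
    size y) *:
    ins p f (fun z => K (z ++ ciota e * a :: x)) y)) +
  cut t (fun w v => (-1) ^+ ((size w).+1 * p) *: cycsum id K (f v * a) w).
  transitivity (cut t (fun x y => cut y (fun u v =>
    (-1) ^+ ((size x).+1 * size y + size u + p.+1) *:
      ins p f (fun z => K (z ++ ciota v * a :: x)) u +
    (-1) ^+ ((size x).+1 * size y + size u * p) *:
      K (u ++ f v * a :: x)))).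
    apply: eq_cut => x y _; rewrite ins_cut cutZ.
    apply: eq_cut => u v _.
    rewrite (cyc_op_size (cyc_op_ins V fc)); last exact: mlin_tail.
    have -> : ins p f (fun e => (-1) ^+ size u *: K (u ++ ciota e * a :: x)) v =
        (-1) ^+ size u *: K (u ++ f v * a :: x).
      rewrite insZ (ins_slot _ _ (fun e => ciota e * a)) //; congr (_ *: K (_
        ++ _ :: _)).
      rewrite (ins_comp _ _ (L := fun b : A => b * a)) ?ins_iota // => b a1 a2.
      by rewrite mulrDl -alg_scalerAl.
    by rewrite scalerDr; congr (_ + _); sgn.
  transitivity (cut t (fun x y => cut y (fun u v =>
    (-1) ^+ ((size x).+1 * size y + size u + p.+1) *:
      ins p f (fun z => K (z ++ ciota v * a :: x)) u)) +
    cut t (fun x y => cut y (fun u v =>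
    (-1) ^+ ((size x).+1 * size y + size u * p) *: K (u ++ f v * a :: x)))).
    by rewrite -cutD; apply: eq_cut => x y _; rewrite -cutD.
  congr (_ + _).
    apply: eq_cut => x y ->; apply: eq_cut => u v ->.
    have [->|e1] := par_case v (@par_iota _ A); last by sgn.
    by rewrite mul0r ins_eq0 ?scaler0 // => z; rewrite slot0.
  rewrite /cycsum; under [RHS]eq_cut do rewrite cutZ.
  transitivity (cut t (fun x y => cut y (fun u v =>
    (-1) ^+ ((size (x ++ u)).+1 * p + (size x).+1 * size u) *:
     K (u ++ f v * a :: x)))).
    apply: eq_cut => x y _; apply: eq_cut => u v ->.
    have [->|fv] := par_case v fp; last by sgn.
    by rewrite mul0r slot0 // !scaler0.
  rewrite cutA; apply: eq_cut => w v _; apply: eq_cut => x u ->.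
  by sgn.
have -> : cut t (fun x r => cut r (fun y e =>
    (-1) ^+ (size t + p.+1 + (size x).+1 * size y) *:
    ins p f (fun z => K (z ++ ciota e * a :: x)) y)) =
  (-1) ^+ (size t + p.+1) *:
    cut t (fun r e => cycsum (@ins _ _ V p f) K (ciota e * a) r).
  rewrite /cycsum -cutA cutZ; apply: eq_cut => x r _.
  by rewrite cutZ; apply: eq_cut => y e _; sgn.
signed_abel.
Qed.

End Rotation.

Arguments cyc_op_id {k A} V.

(** * The trace of a symmetric algebra *)

Section TraceForm.
Variables (k : comPzRingType) (A : algebra k).

(** A symmetrizing form: a trace whose associated bilinear form is perfect. *)
Record trace_form (tau : A -> k^o) : Prop := TraceForm {
  trace_linear : linear tau;
  traceC : forall a b, tau (a * b) = tau (b * a);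
  trace_inj : forall a, (forall x, tau (x * a) = 0) -> a = 0;
  trace_surj : forall L : A -> k^o, linear L ->
    exists a, forall x, L x = tau (x * a)
}.

(** Linear forms are determined by their values. *)
Lemma scalar_ext (u v : {scalar A}) : u =1 v -> u = v.
Proof.
case: u v => [f [[m0] [m1]]] [g [[n0] [n1]]] /= /funext e.
subst g; congr (GRing.Linear.Pack (GRing.Linear.Class _ _)); congr (_ _);
  exact: Prop_irrelevance.
Qed.

(** The form corresponding to 1 under the bimodule isomorphism. *)
Lemma symmetric_trace : symmetric_algebra A ->
  exists tau : A -> k^o, trace_form tau.
Proof.
case=> phi [[psi phiK psiK] phiL phiM]; exists (fun x => phi 1 x).
have phiE a x : phi a x = phi 1 (x * a).
  by have := phiM a 1 1 x; rewrite !mulr1 mul1r.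
split=> [c x y|a b|a a0|L Ll].
- by rewrite linearP.
- by have := phiM 1 1 a b; rewrite !mul1r !mulr1 phiE => ->.
- rewrite -[a]phiK -[RHS]phiK; congr psi; apply: scalar_ext => x.
  by rewrite phiE a0 phiE mulr0 linear0.
pose L' : {scalar A} :=
  HB.pack L (GRing.isLinear.Build k A k^o *%R L Ll).
by exists (psi L') => x; rewrite -phiE psiK.
Qed.

End TraceForm.

(** * The operator of a trace *)

Section TraceOperator.
Variables (k : comPzRingType) (A : algebra k) (tau : A -> k^o).
Hypothesis tauP : trace_form tau.
Implicit Types (r s t u v w x y z : seq A) (a b : A).
Implicit Types (f g h : seq A -> A) (p q m n : nat) (c : k).

Lemma traceD : {morph tau : a b / a + b}.
Proof. by move=> a b; have := trace_linear tauP 1 a b; rewrite !scale1r. Qed.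

Lemma trace0 : tau 0 = 0.
Proof. by apply: (@addrI _ (tau 0)); rewrite -traceD !addr0. Qed.

Lemma traceZ c a : tau (c *: a) = c *: tau a.
Proof. by have := trace_linear tauP c a 0; rewrite trace0 !addr0. Qed.

Lemma traceN a : tau (- a) = - tau a.
Proof. by rewrite -scaleN1r traceZ scaleN1r. Qed.

Lemma trace_sep a b : (forall x : A, tau (x * a) = tau (x * b)) -> a = b.
Proof.
move=> e; apply/eqP; rewrite -subr_eq0; apply/eqP; apply: (trace_inj tauP) => x.
by rewrite mulrBr traceD traceN e subrr.
Qed.

(** The cochain [f] such that [F a t = tau (a * f t)]; it exists when [F] is
    linear in [a], and the value is 0 by convention where it does not. *)
Definition flat (F : A -> seq A -> k^o) t : A :=
  if pselect (exists b, forall a, F a t = tau (a * b)) is left e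
  then sval (cid e) else 0.

Lemma flatE F a t : (forall t, linear (F^~ t)) -> tau (a * flat F t) = F a t.
Proof.
move=> Fl; rewrite /flat; case: pselect => [e|]; first by case: cid => b /= ->.
by case; apply: trace_surj.
Qed.

Lemma mlin_flat F : (forall t, linear (F^~ t)) -> (forall a, mlin (F a)) ->
  mlin (flat F).
Proof.
move=> Fl Fm s t c x y; apply: trace_sep => a.
by rewrite mulrDr -alg_scalerAr traceD traceZ !flatE // Fm.
Qed.

Lemma par_flat p F : (forall t, linear (F^~ t)) -> (forall a, par p (F a)) ->
  par p (flat F).
Proof.
move=> Fl Fp s Ns; apply: trace_sep => a.
by rewrite flatE // Fp // mulr0 trace0.
Qed.

Lemma supp_flat N F : (forall t, linear (F^~ t)) -> (forall a, supp N (F a)) ->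
  supp N (flat F).
Proof.
move=> Fl FN s Ns; apply: trace_sep => a.
by rewrite flatE // FN // mulr0 trace0.
Qed.

Lemma linear_mull a : linear (fun b : A => tau (a * b)).
Proof.
by move=> c x y; rewrite mulrDr -alg_scalerAr (trace_linear tauP).
Qed.

Lemma trace_cut s (P : seq A -> seq A -> A) :
  tau (cut s P) = cut s (fun u v => tau (P u v)).
Proof. exact: cut_raddf traceD. Qed.

Lemma trace_mul_cut a s (P : seq A -> seq A -> A) :
  tau (a * cut s P) = cut s (fun u v => tau (a * P u v)).
Proof.
by apply: (cut_raddf (f := fun b => tau (a * b))) => x y; rewrite mulrDr traceD.
Qed.

(** The differential of a cochain, seen through the trace. *)
Lemma trace_d f a t : mlin f ->
  tau (a * hochschild_d f t) = cyc_d (fun b s => tau (b * f s)) a t.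
Proof.
move=> fl; rewrite hochschild_dE // mulrDr mulrBr -alg_scalerAr.
rewrite !traceD traceN traceZ /cyc_d; congr (_ - _ + _ *: _).
- by rewrite trace_mul_cut; apply: eq_cut => u v _; rewrite mulrA.
- by rewrite (ins_comp _ _ (L := fun b : A => tau (a * b))) //; apply:
  linear_mull.
- rewrite trace_mul_cut; apply: eq_cut => u v _.
  by rewrite mulrA (traceC tauP) mulrA.
Qed.

Lemma cyc_d_eq (F G : A -> seq A -> k^o) a t :
  (forall b s, F b s = G b s) -> cyc_d F a t = cyc_d G a t.
Proof. by move=> e; congr (cyc_d _ a t); apply/funext => b; apply/funext. Qed.

Lemma trace_d_flat F a t :
  (forall t, linear (F^~ t)) -> (forall a, mlin (F a)) ->
  tau (a * hochschild_d (flat F) t) = cyc_d F a t.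
Proof.
move=> Fl Fm; rewrite trace_d; last exact: mlin_flat.
by apply: cyc_d_eq => b s; rewrite flatE.
Qed.

Lemma mlin_trace g : mlin g -> mlin (fun s => tau (g s)).
Proof. exact: mlin_comp (trace_linear tauP). Qed.

(** The transpose of the operator of Connes. *)
Definition connes g : seq A -> A := flat (cycsum id (fun s => tau (g s))).

Lemma connesE g a t : mlin g ->
  tau (a * connes g t) = cycsum id (fun s => tau (g s)) a t.
Proof.
move=> gl; apply: flatE => s.
exact: (linear_cycsum (cyc_op_id _)) (mlin_trace gl).
Qed.

Lemma mlin_connes g : mlin g -> mlin (connes g).
Proof.
move=> /mlin_trace gl; apply: mlin_flat => *.
  exact: (linear_cycsum (cyc_op_id _)).
exact: (mlin_cycsum (cyc_op_id _)).
Qed.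

Lemma par_connes p g : mlin g -> par p g -> par p.+1 (connes g).
Proof.
move=> gl gp; apply: par_flat => [t|a s Ns].
  exact: (linear_cycsum (cyc_op_id _)) (mlin_trace gl).
apply: cut_zero => u v es; rewrite gp ?trace0 ?scaler0 //.
by apply: contra Ns => /eqP e; apply/eqP; move: e; rewrite es; parity.
Qed.

Lemma supp_connes N g : mlin g -> supp N g -> supp N (connes g).
Proof.
move=> gl gN; apply: supp_flat => [t|a s Ns].
  exact: (linear_cycsum (cyc_op_id _)) (mlin_trace gl).
apply: cut_zero => u v es; rewrite gN ?trace0 ?scaler0 //.
by move: Ns; rewrite es !size_cat /=; lia.
Qed.

Lemma connes_comb c f g t : mlin f -> mlin g ->
  connes (fun s => c *: f s + g s) t = c *: connes f t + connes g t.
Proof.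
move=> fl gl; apply: trace_sep => a.
rewrite mulrDr -alg_scalerAr traceD traceZ !connesE //; last exact: mlin_comb.
rewrite /cycsum cutZ -cutD; apply: eq_cut => x y _.
by rewrite traceD traceZ scalerDr !scalerA mulrC.
Qed.

Lemma connes_zero g t : (forall s, g s = 0) -> mlin g -> connes g t = 0.
Proof.
move=> g0 gl; apply: trace_sep => a; rewrite connesE // mulr0 trace0.
by apply: cut_zero => x y _; rewrite g0 trace0 scaler0.
Qed.

Lemma conv_iota_cat g y a x :
  conv ciota g (y ++ a :: x) =
  conv ciota (fun z => g (z ++ a :: x)) y + cone y * (a * g x).
Proof.
rewrite conv_cat; congr (_ + _); rewrite /conv cut_l0 => [|b u v].
  by rewrite iota_cat /= mulr1 mulrA.
by rewrite iota_cat /= !mulr0 mul0r.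
Qed.

Lemma conv_iotar_cat g y a x :
  conv g ciota (y ++ a :: x) =
  conv (fun z => g (y ++ a :: z)) ciota x + g y * a * cone x.
Proof.
rewrite conv_cat addrC; congr (_ + _); rewrite /conv cut_r0 => [|u b v].
  by rewrite iota_cat /= mul1r mulrA.
by rewrite iota_cat /= mul0r mulr0.
Qed.

(** The two outer terms of the differential cancel in a cyclic sum. *)
Lemma cycsum_outer g a t :
  cycsum id (fun s => tau (conv ciota g s + (-1) ^+ size s *: conv g ciota s))
    a t = 0.
Proof.
pose S1 := cut t (fun x r => cut r (fun e y =>
  (-1) ^+ ((size x).+1 * (size y).+1) *: tau (ciota e * g (y ++ a :: x)))).
have -> : cycsum id (fun s => tau (conv ciota g s +
      (-1) ^+ size s *: conv g ciota s)) a t =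
    S1 + tau (a * g t) - S1 - tau (a * g t).
  transitivity (cut t (fun x y => cut y (fun e y' =>
      (-1) ^+ ((size x).+1 * size y) *: tau (ciota e * g (y' ++ a :: x)))) +
    cut t (fun x y => (-1) ^+ ((size x).+1 * size y) *:
      tau (cone y * (a * g x))) +
    cut t (fun x y => cut x (fun x' e =>
      (-1) ^+ ((size x).+1 * size y + size t + 1) *:
        tau (g (y ++ a :: x') * ciota e))) +
    cut t (fun x y => (-1) ^+ ((size x).+1 * size y + size t + 1) *:
      tau (g y * a * cone x))).
    rewrite -!cutD; apply: eq_cut => x y ->.
    rewrite conv_iota_cat conv_iotar_cat /= traceD traceZ !traceD !scalerDr.
    rewrite /conv !trace_cut !cutZ -!addrA; congr (_ + (_ + _)).
    congr (_ + _); last by sgn.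
    by apply: eq_cut => x' e _; sgn.
  congr (_ + _ + _ + _).
  - apply: eq_cut => x r _; apply: eq_cut => e y ->.
    have [->|e1] := par_case e (@par_iota _ A); last by sgn.
    by rewrite mul0r trace0 !scaler0.
  - rewrite cut_r0 /= => [|u b v]; last by rewrite mul0r trace0 scaler0.
    by rewrite muln0 expr0 scale1r mul1r.
  - transitivity (cut t (fun x y => cut x (fun x' e =>
        (-1) ^+ ((size (x' ++ e)).+1 * size y + size t + 1) *:
        tau (g (y ++ a :: x') * ciota e)))).
      by apply: eq_cut => x y _; apply: eq_cut => x' e ->.
    rewrite -cutA -cutN; apply: eq_cut => x r et; rewrite -cutN.
    apply: eq_cut => e y er; rewrite (traceC tauP) -signS et er.
    have [->|e1] := par_case e (@par_iota _ A); last by sgn.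
    by rewrite mul0r trace0 !scaler0.
  - rewrite cut_l0 /= => [|b u v]; last by rewrite mulr0 trace0 scaler0.
    by rewrite mulr1 (traceC tauP); signed_abel.
by abel.
Qed.

(** The operator anticommutes with the differential. *)
Lemma connes_d g t : mlin g ->
  connes (hochschild_d g) t = - hochschild_d (connes g) t.
Proof.
move=> gl; apply: trace_sep => a; rewrite mulrN traceN.
rewrite connesE; last exact: mlin_d.
rewrite trace_d_flat => [|s|b].
- rewrite cyc_d_cycsum_id; last exact: mlin_trace.
  rewrite -[RHS]add0r -(cycsum_outer g a t) /cycsum -cutB.
  apply: eq_cut => x y _; rewrite -scalerBr; congr (_ *: _).
  rewrite (@ins_comp k A A k^o 2 cmu tau g _ (trace_linear tauP)).
  rewrite hochschild_dE //.
  by rewrite addrAC [in LHS]traceD traceN.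
- exact: (linear_cycsum (cyc_op_id _)) (mlin_trace gl).
- exact: (mlin_cycsum (cyc_op_id _)) (mlin_trace gl).
Qed.

(** A cyclic sum is invariant under rotations, up to sign. *)
Lemma cycsum_rotate (K : seq A -> k^o) a b s :
  cycsum id K a (b :: s) = (-1) ^+ (size s).+1 *: cycsum id K b (rcons s a).
Proof.
rewrite [LHS]/cycsum [LHS]/= [LHS]addrC /cycsum -cats1 cut_cat_cons scalerDr.
congr (_ + _).
  rewrite cutZ; apply: eq_cut => x y ->.
  by rewrite -catA /=; sgn.
by rewrite /=; sgn.
Qed.

(** The operator squares to a homotopically trivial map. *)
Lemma connes_connes g t : mlin g -> hochschild_d g =1 (fun=> 0) ->
  connes (connes g) t =
  hochschild_d (flat (cycsum id (fun s => tau (connes g (1 :: s))))) t.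
Proof.
move=> gl dg; have bl := mlin_connes gl.
have b1l : mlin (fun s => tau (connes g (1 :: s))).
  exact/mlin_trace/(mlin_head [:: 1]).
have dbg s : hochschild_d (connes g) s = 0.
  by apply/eqP; rewrite -oppr_eq0 -connes_d //; apply/eqP/connes_zero => //;
    apply: mlin_d.
apply: trace_sep => a; rewrite connesE // trace_d_flat => [|s|b]; first last.
- exact: (mlin_cycsum (cyc_op_id _)).
- exact: (linear_cycsum (cyc_op_id _)).
rewrite cyc_d_cycsum_id //; apply: eq_cut => x y _; congr (_ *: _).
move: (y ++ a :: x) (size_cat y (a :: x)) => s.
rewrite addnS; case/lastP: s => // s z _ /=.
rewrite (@ins_comp k A A k^o 2 cmu tau (fun s => connes g (1 :: s)) _
  (trace_linear tauP)).
(* At a list that starts with 1 the cocycle equation of [connes g] computes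
   the inner terms of its restriction to such lists. *)
have := dbg (1 :: rcons s z).
rewrite hochschild_dE // conv_iota_cons mul1r mu_ins_cons //.
have -> : (if rcons s z is b :: r then connes g (1 * b :: r) else 0) =
    connes g (rcons s z) by case: s => [|b s] /=; rewrite mul1r.
rewrite -rcons_cons conv_iota_rcons subKr => /eqP; rewrite addr_eq0 => /eqP ->.
rewrite traceN traceZ (traceC tauP) connesE // cycsum_rotate -connesE // mul1r.
rewrite size_rcons; signed_abel.
Qed.

(** The rotations of the product of [f] and [g] in which the distinguished
    argument [a] belongs to [g]. *)
Definition half_sum f g a t : k^o :=
  cut t (fun x y => (-1) ^+ ((size x).+1 * size y) *:
    tau (conv f (fun z => g (z ++ a :: x)) y)).

(** The cyclic sum with [f] inserted among the arguments of [g] preceding the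
    distinguished one. *)
Definition half_homotopy p f g : seq A -> A :=
  flat (cycsum (@ins _ _ k^o p f) (fun s => tau (g s))).

(** In a rotation of the product of [f] and [g], the first argument [a] goes
    either to [g] or to [f]. *)
Lemma connes_conv p q f g a t : par p f -> par q g -> mlin f -> mlin g ->
  tau (a * connes (conv f g) t) =
  half_sum f g a t + (-1) ^+ (p * q) *: half_sum g f a t.
Proof.
move=> fp gq fl gl; rewrite connesE; last exact: mlin_conv.
transitivity (half_sum f g a t + cut t (fun x y => cut x (fun u v =>
    (-1) ^+ ((size (u ++ v)).+1 * size y) *: tau (f (y ++ a :: u) * g v)))).
  rewrite -cutD; apply: eq_cut => x y _; rewrite conv_cat traceD scalerDr.
  congr (_ + _); rewrite /conv trace_cut cutZ.
  by apply: eq_cut => u v ->.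
congr (_ + _); rewrite -cutA cutZ; apply: eq_cut => x r _.
rewrite /conv trace_cut !cutZ; apply: eq_cut => v y ->.
rewrite (traceC tauP); have [->|gv] := par_case v gq.
  by rewrite mul0r trace0 !scaler0.
have [->|fy] := par_case (y ++ a :: x) fp; first by rewrite mulr0 trace0
  !scaler0.
by sgn.
Qed.

(** The insertion of [f] in the two outer terms of the differential of [g],
    before the letter [a]. *)
Lemma ins_outer p q f g a x y : par_cocycle p f -> par_cocycle q g ->
  ins p f (fun z => ins 2 cmu (fun s => tau (g s)) (z ++ a :: x)) y =
  tau (conv f (fun z => g (z ++ a :: x)) y) +
  (-1) ^+ p.+1 *:
    tau (conv ciota (ins p f (fun z => g (z ++ a :: x))) y) -
  (-1) ^+ q *: (cut x (fun x' e =>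
    tau (ins p f (fun z => g (z ++ a :: x')) y * ciota e)) +
    tau (ins p f g y * (a * cone x))).
Proof.
move=> fc gc; have [[fl fp _] [gl gq _]] := (fc, gc).
have mulrl b : linear (fun c : A => c * b).
  by move=> c b1 b2; rewrite mulrDl -alg_scalerAl.
rewrite (@eq_ins _ _ _ _ _ _ (fun z => tau (
    conv ciota (fun z => g (z ++ a :: x)) z + cone z * (a * g x) -
    (-1) ^+ q *: (cut x (fun x' e => g (z ++ a :: x') * ciota e) +
                  g z * (a * cone x))))) => [|z]; last first.
  rewrite (@ins_comp k A A k^o 2 cmu tau g _ (trace_linear tauP)).
  by rewrite (par_cocycle_mu _ gc) conv_iota_cat conv_iotar_cat -mulrA.
rewrite (@ins_comp k A A k^o p f tau _ _ (trace_linear tauP)).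
rewrite insB insZ !insD ins_sum.
rewrite (@ins_comp k A A A p f (fun b => b * (a * g x)) cone _ (mulrl _)).
rewrite (@ins_comp k A A A p f (fun b => b * (a * cone x)) g _ (mulrl _)).
rewrite ins_one mul0r addr0.
rewrite (ins_conv _ _ (@par_iota _ A) fp (@mlin_iota _ A)) mul1n.
rewrite (eq_conv (@ins_iota _ _ p f) (frefl _)).
rewrite traceD traceN traceD !traceZ traceD (trace_cut x).
congr (_ + _ - _ *: (_ + _)); apply: eq_cut => x' e _; congr (tau _).
exact: (@ins_comp k A A A p f (fun b => b * ciota e) _ _ (mulrl _)).
Qed.

(** In the cyclic sum of the outer terms of the differential of [g] the
    contributions where neither [f] nor [a] becomes an outer factor cancel
    in pairs. *)
Lemma cycsum_half p q f g a t : par_cocycle p f -> par_cocycle q g ->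
  cycsum (@ins _ _ k^o p f) (ins 2 cmu (fun s => tau (g s))) a t =
  half_sum f g a t + (-1) ^+ p *: tau (a * ins p f g t).
Proof.
move=> fc gc; have [[fl fp _] [gl gq _]] := (fc, gc).
pose S1 := cut t (fun x r => cut r (fun e y => (-1) ^+ (size x * size y + q) *:
  tau (ins p f (fun z => g (z ++ a :: x)) y * ciota e))).
transitivity (half_sum f g a t + S1 - S1 -
  cut t (fun x y => (-1) ^+ ((size x).+1 * size y + q) *:
    tau (ins p f g y * (a * cone x)))).
  transitivity (half_sum f g a t +
    cut t (fun x y => cut y (fun e y' =>
      (-1) ^+ ((size x).+1 * size y + p.+1) *:
        tau (ciota e * ins p f (fun z => g (z ++ a :: x)) y'))) -
    cut t (fun x y => cut x (fun x' e => (-1) ^+ ((size x).+1 * size y + q) *: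
      tau (ins p f (fun z => g (z ++ a :: x')) y * ciota e))) -
    cut t (fun x y => (-1) ^+ ((size x).+1 * size y + q) *:
      tau (ins p f g y * (a * cone x)))).
    rewrite -cutD -!cutB; apply: eq_cut => x y _.
    rewrite (ins_outer _ _ _ fc gc) !scalerDr scalerN scalerDr opprD !addrA.
    congr (_ + _ - _ - _); last by sgn.
      rewrite /conv trace_cut !cutZ; apply: eq_cut => e y' _; sgn.
    by rewrite !cutZ; apply: eq_cut => x' e _; sgn.
  congr (_ + _ - _ - _).
    apply: eq_cut => x r _; apply: eq_cut => e y ->; rewrite (traceC tauP).
    have [->|e1] := par_case e (@par_iota _ A).
      by rewrite mulr0 trace0 !scaler0.
    have gx : par (q + size x).+1 (fun z => g (z ++ a :: x)).
      move=> z Nz; apply: gq; apply: contra Nz => /eqP; rewrite size_cat /= =>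
        e2.
      by apply/eqP; parity.
    have [->|ey] := par_case y (par_ins fp gx (mlin_tail (a :: x) gl)).
      by rewrite mul0r trace0 !scaler0.
    by sgn.
  transitivity (cut t (fun x y => cut x (fun x' e =>
      (-1) ^+ ((size (x' ++ e)).+1 * size y + q) *:
      tau (ins p f (fun z => g (z ++ a :: x')) y * ciota e)))).
    by apply: eq_cut => x y _; apply: eq_cut => x' e ->.
  rewrite -cutA; apply: eq_cut => x r _; apply: eq_cut => e y _.
  have [->|e1] := par_case e (@par_iota _ A); last by sgn.
  by rewrite mulr0 trace0 !scaler0.
rewrite cut_l0 /= => [|b u v]; last by rewrite !mulr0 trace0 scaler0.
rewrite mulr1 (traceC tauP) addrK.
have [->|et] := par_case t (par_ins fp gq gl).
  by rewrite mulr0 trace0 !scaler0 subr0 addr0.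
by rewrite -signS; congr (_ + _); sgn.
Qed.

(** The differential of the cyclic homotopy, one half of the
    Batalin-Vilkovisky identity. *)
Lemma d_half_homotopy p q f g a t : par_cocycle p f -> par_cocycle q g ->
  tau (a * hochschild_d (half_homotopy p f g) t) =
  (-1) ^+ p.+1 *: half_sum f g a t - tau (a * ins p f g t) +
  (-1) ^+ (p + p * q) *: tau (a * conv (connes g) f t).
Proof.
move=> fc gc; have [[fl fp _] [gl gq _]] := (fc, gc).
rewrite trace_d_flat => [|s|b]; first last.
- exact: (mlin_cycsum (cyc_op_ins _ fc)) (mlin_trace gl).
- exact: (linear_cycsum (cyc_op_ins _ fc)) (mlin_trace gl).
rewrite (cyc_d_cycsum_ins _ _ fc (mlin_trace gl)); congr (_ + _); last first.
  rewrite exprD -scalerA; congr (_ *: _).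
  rewrite trace_mul_cut cutZ; apply: eq_cut => w v _.
  rewrite mulrA (traceC tauP) mulrA -connesE //.
  have [->|ew] := par_case w (par_connes gl gq); last by sgn.
  by rewrite mulr0 trace0 !scaler0.
rewrite (cycsum_half _ _ fc gc) scalerDr; congr (_ + _).
signed_abel.
Qed.

(** The Batalin-Vilkovisky identity, up to an explicit homotopy. *)
Lemma bracket_connes p q f g t : par_cocycle p f -> par_cocycle q g ->
  bracket p q f g t =
  (-1) ^+ (q + p * q) *: (conv (connes f) g t - connes (conv f g) t) +
  (-1) ^+ q *: conv (connes g) f t +
  ((-1) ^+ (p.+1 * q.+1) *: hochschild_d (half_homotopy p f g) t -
   hochschild_d (half_homotopy q g f) t).
Proof.
move=> fc gc; have [[fl fp _] [gl gq _]] := (fc, gc).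
apply: trace_sep => a; rewrite /bracket !(mulrBr, mulrDr) -!alg_scalerAr.
rewrite !(traceD, traceN, traceZ) !(mulrBr, mulrDr) !(traceD, traceN, traceZ).
rewrite (d_half_homotopy _ _ fc gc) (d_half_homotopy _ _ gc fc).
rewrite (connes_conv _ _ fp gq) // (mulnC q p).
set X1 := tau (a * conv (connes f) g t); set X2 := tau (a * ins q g f t).
signed_abel.
Qed.

Lemma supp_cycsum_id N (K : seq A -> k^o) a : supp N K -> supp N (cycsum id K
  a).
Proof.
move=> KN s Ns; apply: cut_zero => u v es; rewrite KN ?scaler0 //.
by move: Ns; rewrite es !size_cat /=; lia.
Qed.

Lemma mlin_half_homotopy p f g : par_cocycle p f -> mlin g ->
  mlin (half_homotopy p f g).
Proof.
move=> fc /mlin_trace gl; apply: mlin_flat => *.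
  exact: (linear_cycsum (cyc_op_ins _ fc)).
exact: (mlin_cycsum (cyc_op_ins _ fc)).
Qed.

Lemma supp_half_homotopy p M N f g : par_cocycle p f -> mlin g ->
  supp M f -> supp N g -> supp (M + N) (half_homotopy p f g).
Proof.
move=> fc /mlin_trace gl fM gN; apply: supp_flat => [t|a s Ns].
  exact: (linear_cycsum (cyc_op_ins _ fc)).
apply: cut_zero => x y es; case: (leqP N (size x)) => [le_x|lt_x].
  rewrite ins_eq0 ?scaler0 // => z; rewrite gN ?trace0 //.
  by rewrite size_cat /=; lia.
have gx : supp (N - size x) (fun z => tau (g (z ++ a :: x))).
  by move=> z Nz; rewrite gN ?trace0 // size_cat /=; lia.
rewrite (supp_ins p fM gx) ?scaler0 //; first exact: (mlin_tail _ gl).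
by move: Ns; rewrite es size_cat; lia.
Qed.

End TraceOperator.

(** * Cohomology classes *)

Section Classes.
Variables (k : comPzRingType) (A : algebra k).
Implicit Types (s t u v w : seq A) (a b : A) (c : k).
Implicit Types (f g h : seq A -> A) (p q m n : nat).
Local Notation HH := (hochschild_cohomology A).

(** Cocycles, as functions. *)
Definition is_cocycle f : Prop := cochain f /\ hochschild_d f = 0.

Lemma cochain_supp f : mlin f -> (exists N, supp N f) -> cochain f.
Proof. by move=> fl [N fN]; split=> //; exists N => s Ns; apply/fN/ltnW. Qed.

Lemma supp_cochain f : cochain f -> exists N, supp N f.
Proof. by case=> _ [N fN]; exists N.+1. Qed.

Lemma cochain_mlin f : cochain f -> mlin f.
Proof. by case. Qed.

Lemma cocycle_mlin f : is_cocycle f -> mlin f.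
Proof. by case=> /cochain_mlin. Qed.

Lemma cocycle_d f s : is_cocycle f -> hochschild_d f s = 0.
Proof. by case=> _ ->. Qed.

Lemma is_cocycleI f : cochain f -> (forall s, hochschild_d f s = 0) ->
  is_cocycle f.
Proof. by move=> fc fd; split=> //; apply/funext => s; rewrite fd. Qed.

Lemma is_cocycle_par p f : is_cocycle f -> par p f -> par_cocycle p f.
Proof. by case=> fc fd fp; split=> // [|s]; [apply: cochain_mlin|rewrite fd].
  Qed.

Lemma cocycle_comb c f g : is_cocycle f -> is_cocycle g -> is_cocycle (c *: f +
  g).
Proof.
case=> fc fd [gc gd]; split; first by apply: (proj2 (cochain_submod A)).
by rewrite hochschild_d_linear fd gd scaler0 addr0.
Qed.

Lemma cocycle0 : is_cocycle 0.
Proof. by split; [apply: (proj1 (cochain_submod A))|apply: hochschild_d0]. Qed.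

Lemma cocycleZ c f : is_cocycle f -> is_cocycle (c *: f).
Proof. by move=> fz; rewrite -[_ *: _]addr0; apply: cocycle_comb cocycle0. Qed.

Lemma cocycleD f g : is_cocycle f -> is_cocycle g -> is_cocycle (f + g).
Proof. by move=> fz gz; rewrite -[f]scale1r; apply: cocycle_comb. Qed.

Lemma cocycle_valP (z : cocycle A) : is_cocycle z.
Proof. by have /asboolP := valP z. Qed.

(** The class of a cocycle; by convention it is 0 for other functions. *)
Definition cls f : HH := if insub f is Some z then cohomology_class z else 0.

Lemma cls_val (z : cocycle A) : cls z = cohomology_class z.
Proof. by rewrite /cls -[cocycle_val z]/(val z) valK. Qed.

Lemma cocycle_ex f : is_cocycle f -> exists z : cocycle A, cocycle_val z = f.
Proof.
move=> /asboolP fz; have fz' : f \in @cocycle_pred k A by [].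
by exists (Cocycle fz').
Qed.

Lemma clsP c f g : is_cocycle f -> is_cocycle g -> cls (c *: f + g) = c *: cls
  f + cls g.
Proof.
move=> /cocycle_ex[y <-] /cocycle_ex[z <-]; rewrite !cls_val.
rewrite -[c *: _ + _]/(cocycle_val (c *: y + z)) cls_val.
rewrite /cohomology_class lmod_quot_piD; congr (_ + _).
exact: lmod_quot_piZ.
Qed.

Lemma cls0 : cls 0 = 0.
Proof. by have := clsP (-1) cocycle0 cocycle0; rewrite scaler0 addr0 scaleN1r
  addNr. Qed.

Lemma clsD f g : is_cocycle f -> is_cocycle g -> cls (f + g) = cls f + cls g.
Proof. by move=> fz gz; have := clsP 1 fz gz; rewrite !scale1r. Qed.

Lemma clsZ c f : is_cocycle f -> cls (c *: f) = c *: cls f.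
Proof. by move=> fz; have := clsP c fz cocycle0; rewrite cls0 !addr0. Qed.

Lemma cls_eqP f g : is_cocycle f -> is_cocycle g ->
  cls f = cls g <-> exists h, cochain h /\ hochschild_d h = f - g.
Proof.
move=> /cocycle_ex[y <-] /cocycle_ex[z <-]; rewrite !cls_val; split=> [/eqP|[h
  hP]].
  by rewrite lmod_quot_eq => /asboolP.
by apply/eqP; rewrite lmod_quot_eq; apply/asboolP; exists h.
Qed.

Lemma cls_eq f g h : is_cocycle f -> is_cocycle g -> cochain h ->
  (forall s, f s = g s + hochschild_d h s) -> cls f = cls g.
Proof.
move=> fz gz hc e; apply/cls_eqP => //; exists h; split=> //.
by apply/funext => s; rewrite !fctE e addrAC subrr add0r.
Qed.

Lemma cls_surj x : exists f, is_cocycle f /\ cls f = x.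
Proof.
exists (repr x : cocycle A); split; first exact: cocycle_valP.
by rewrite cls_val /cohomology_class lmod_quot_piK.
Qed.

End Classes.

(** * Operations on cohomology *)

Section Lifting.
Variables (k : comPzRingType) (A : algebra k).
Implicit Types (s t u v w : seq A) (a b : A) (c : k).
Implicit Types (f g h : seq A -> A) (p q m n : nat).
Local Notation HH := (hochschild_cohomology A).

(** A representative of a class. *)
Definition rep (x : HH) : seq A -> A := repr x : cocycle A.

Lemma cocycle_rep x : is_cocycle (rep x).
Proof. exact: cocycle_valP. Qed.

Lemma cls_rep x : cls (rep x) = x.
Proof. by rewrite /rep cls_val /cohomology_class lmod_quot_piK. Qed.

Definition boundary f : Prop := exists h, cochain h /\ hochschild_d h = f.

Lemma cls_boundary f g : is_cocycle f -> is_cocycle g -> boundary (f - g) ->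
  cls f = cls g.
Proof. by move=> fz gz [h hP]; apply/cls_eqP => //; exists h. Qed.

(** A map on cochains, linear and compatible with the differential enough to
    induce a linear map on cohomology classes; [operation2] is the bilinear
    analogue. *)
Record operation (F : (seq A -> A) -> seq A -> A) : Prop := Operation {
  operation_cocycle : forall f, is_cocycle f -> is_cocycle (F f);
  operation_comb : forall c f g, cochain f -> cochain g ->
    F (c *: f + g) = c *: F f + F g;
  operation_d : forall h, cochain h -> boundary (F (hochschild_d h))
}.

(** The maps induced on classes, computed on chosen representatives;
    [hliftE] and [hlift2E] show that the choice does not matter. *)
Definition hlift F (x : HH) : HH := cls (F (rep x)).

Lemma operationB F f g : operation F -> cochain f -> cochain g ->
  F f - F g = F (f - g).
Proof.
move=> Fop fc gc; rewrite addrC -scaleN1r -(operation_comb Fop) //.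
by rewrite scaleN1r addrC.
Qed.

Lemma hliftE F f : operation F -> is_cocycle f -> hlift F (cls f) = cls (F f).
Proof.
move=> Fop fz; have rz := cocycle_rep (cls f).
apply: cls_boundary; try exact: operation_cocycle.
rewrite operationB //; [|by case: rz|by case: fz].
have [h [hc <-]] : boundary (rep (cls f) - f).
  by apply/cls_eqP => //; rewrite cls_rep.
exact: operation_d.
Qed.

Lemma hlift_linear F : operation F -> linear (hlift F).
Proof.
move=> Fop c x y; have [[f [fz <-]] [g [gz <-]]] := (cls_surj x, cls_surj y).
rewrite -clsP // !hliftE //; last exact: cocycle_comb.
rewrite (operation_comb Fop); [|by case: fz|by case: gz].
by rewrite clsP //; apply: operation_cocycle.
Qed.

Record operation2 (F : (seq A -> A) -> (seq A -> A) -> seq A -> A) : Prop :=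
  Operation2 {
  operation2_cocycle : forall f g, is_cocycle f -> is_cocycle g -> is_cocycle
    (F f g);
  operation2_combl : forall c f f' g, F (c *: f + f') g = c *: F f g + F f' g;
  operation2_combr : forall c f g g', F f (c *: g + g') = c *: F f g + F f g';
  operation2_dl : forall h g, cochain h -> is_cocycle g ->
    boundary (F (hochschild_d h) g);
  operation2_dr : forall f h, is_cocycle f -> cochain h ->
    boundary (F f (hochschild_d h))
}.

Definition hlift2 F (x y : HH) : HH := cls (F (rep x) (rep y)).

Lemma hlift2E F f g : operation2 F -> is_cocycle f -> is_cocycle g ->
  hlift2 F (cls f) (cls g) = cls (F f g).
Proof.
move=> Fop fz gz; have [rz rz'] := (cocycle_rep (cls f), cocycle_rep (cls g)).
transitivity (cls (F f (rep (cls g)))).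
  apply: cls_boundary; try exact: operation2_cocycle.
  have [h [hc hd]] : boundary (rep (cls f) - f).
    by apply/cls_eqP => //; rewrite cls_rep.
  have -> : rep (cls f) = 1 *: hochschild_d h + f.
    by rewrite hd scale1r subrK.
  rewrite (operation2_combl Fop) scale1r addrK.
  exact: operation2_dl.
apply: cls_boundary; try exact: operation2_cocycle.
have [h [hc hd]] : boundary (rep (cls g) - g).
  by apply/cls_eqP => //; rewrite cls_rep.
have -> : rep (cls g) = 1 *: hochschild_d h + g.
  by rewrite hd scale1r subrK.
rewrite (operation2_combr Fop) scale1r addrK.
exact: operation2_dr.
Qed.

Lemma hlift2_linearl F y : operation2 F -> linear (hlift2 F ^~ y).
Proof.
move=> Fop c x x'.
have [[f [fz <-]] [f' [fz' <-]]] := (cls_surj x, cls_surj x').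
have [g [gz <-]] := cls_surj y.
rewrite -clsP // !hlift2E //; last exact: cocycle_comb.
by rewrite (operation2_combl Fop) clsP //; apply: operation2_cocycle.
Qed.

Lemma hlift2_linearr F x : operation2 F -> linear (hlift2 F x).
Proof.
move=> Fop c y y'.
have [[g [gz <-]] [g' [gz' <-]]] := (cls_surj y, cls_surj y').
have [f [fz <-]] := cls_surj x.
rewrite -clsP // !hlift2E //; last exact: cocycle_comb.
by rewrite (operation2_combr Fop) clsP //; apply: operation2_cocycle.
Qed.

(** The involution by the sign of the degree. *)
Definition ceps f s : A := (-1) ^+ size s *: f s.

Lemma cepsK f : ceps (ceps f) = f.
Proof. by apply/funext => s; rewrite /ceps; signed_abel. Qed.

Lemma mlin_ceps f : mlin f -> mlin (ceps f).
Proof. exact: (@mlin_size _ _ _ (fun n => (-1) ^+ n)). Qed.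

Lemma d_ceps f : mlin f -> hochschild_d (ceps f) = - ceps (hochschild_d f).
Proof.
move=> fl; apply/funext => s; rewrite !fctE /ceps hochschild_dE; last first.
  exact: mlin_ceps.
rewrite hochschild_dE // !scalerDr !opprD scalerN.
congr (_ - _ + _).
- rewrite -signS /conv cutZ; apply: eq_cut => u v ->.
  have [->|u1] := par_case u (@par_iota _ A); first by rewrite !mul0r !scaler0.
  by rewrite -alg_scalerAr; sgn.
- rewrite (@eq_ins _ _ _ _ _ _ (fun s => (-1) ^+ (size s * 1) *: f s)) => [|t].
    by rewrite (ins_size _ _ (@par_mu _ A)) // -signS; sgn.
  by rewrite muln1.
- rewrite -!signS /conv !cutZ; apply: eq_cut => u v ->.
  have [->|v1] := par_case v (@par_iota _ A); first by rewrite !mulr0 !scaler0.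
  by rewrite -alg_scalerAl; sgn.
Qed.

Lemma ceps_comb c f g : ceps (c *: f + g) = c *: ceps f + ceps g.
Proof.
by apply/funext => s; rewrite /ceps !fctE scalerDr !scalerA (mulrC c).
Qed.

Lemma cochain_ceps f : cochain f -> cochain (ceps f).
Proof.
case=> fl [N fN]; split; first exact: mlin_ceps.
by exists N => s /fN; rewrite /ceps => ->; rewrite scaler0.
Qed.

Lemma cocycle_ceps f : is_cocycle f -> is_cocycle (ceps f).
Proof.
case=> fc fd; split; first exact: cochain_ceps.
rewrite d_ceps; last exact: cochain_mlin.
by rewrite fd; apply/funext => s; rewrite !fctE /ceps scaler0 oppr0.
Qed.

Lemma ceps_operation : operation ceps.
Proof.
split=> [f|c f g _ _|h hc]; [exact: cocycle_ceps|exact: ceps_comb|].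
exists (- ceps h); split; last first.
  rewrite -[- ceps h]scaleN1r -[_ *: _]addr0 hochschild_d_linear hochschild_d0.
  by rewrite d_ceps ?scaleN1r ?addr0 ?opprK //; apply: cochain_mlin.
rewrite -scaleN1r -[_ *: _]addr0; apply: (proj2 (cochain_submod A)).
  exact: cochain_ceps.
exact: (proj1 (cochain_submod A)).
Qed.

(** The part of a cochain in the degrees that satisfy [P]. *)
Definition part (P : pred nat) f s : A := if P (size s) then f s else 0.

Lemma mlin_part P f : mlin f -> mlin (part P f).
Proof.
move=> fl s t c x y; rewrite /part fl !size_cat /=.
by case: ifP => // _; rewrite scaler0 addr0.
Qed.

Lemma d_part P f : hochschild_d (part P f) =
  part (fun n => P n.-1) (hochschild_d f).
Proof.
apply/funext => -[|a t]; first by rewrite /part /=; case: ifP.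
rewrite /part /= size_belast.
transitivity (a * (if P (size t) then f t else 0)
    + \sum_(i < size t) (-1) ^+ i.+1 *: (if P (size t) then
        f (take i (a :: t) ++ ((a :: t)`_i * (a :: t)`_i.+1)
           :: drop i.+2 (a :: t)) else 0)
    + (-1) ^+ (size t).+1 *:
      ((if P (size t) then f (belast a t) else 0) * last a t)).
  congr (_ + _ + _); apply: eq_bigr => i _; congr (_ *: _).
  rewrite (_ : size _ = size t) // size_cat /= size_drop size_takel /=.
    by move: (ltn_ord i); lia.
  by apply/ltnW; rewrite ltnS ltnW.
case: ifP => // _; rewrite mulr0 mul0r scaler0 big1 ?addr0 // => i _.
by rewrite scaler0.
Qed.

Lemma cochain_part P f : cochain f -> cochain (part P f).
Proof.
case=> fl [N fN]; split; first exact: mlin_part.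
by exists N => s /fN; rewrite /part => ->; case: ifP.
Qed.

Lemma cocycle_part P f : is_cocycle f -> is_cocycle (part P f).
Proof.
case=> fc fd; split; first exact: cochain_part.
by rewrite d_part fd; apply/funext => s; rewrite /part; case: ifP.
Qed.

Lemma par_part (b : bool) f : par (~~ b) (part (fun n => odd n != b) f).
Proof. by move=> s; rewrite /part; case: b; case: (odd (size s)). Qed.

Lemma part_sum (b : bool) f : f = part (fun n => odd n != b) f +
                         part (fun n => odd n != ~~ b) f.
Proof.
apply/funext => s; rewrite fctE /part.
by case: b; case: (odd (size s)); rewrite ?addr0 ?add0r.
Qed.

(** The cup product with its Koszul sign, on cochains that need not be
    homogeneous. *)
Definition cup f g s : A :=
  cut s (fun u v => (-1) ^+ (size u * size v) *: (f u * g v)).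

Lemma cup_combl c f f' g : cup (c *: f + f') g = c *: cup f g + cup f' g.
Proof.
apply/funext => s; rewrite !fctE /cup cutZ -cutD; apply: eq_cut => u v _.
by rewrite ?fctE mulrDl -alg_scalerAl scalerDr !scalerA mulrC.
Qed.

Lemma cup_combr c f g g' : cup f (c *: g + g') = c *: cup f g + cup f g'.
Proof.
apply/funext => s; rewrite !fctE /cup cutZ -cutD; apply: eq_cut => u v _.
by rewrite ?fctE mulrDr -alg_scalerAr scalerDr !scalerA mulrC.
Qed.

Lemma cupDl f f' g : cup (f + f') g = cup f g + cup f' g.
Proof. by rewrite -[f]scale1r cup_combl !scale1r. Qed.

Lemma cup0l g : cup 0 g = 0.
Proof. by apply/funext => s; apply: cut_zero => *; rewrite mul0r scaler0. Qed.

Lemma cup0r f : cup f 0 = 0.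
Proof. by apply/funext => s; apply: cut_zero => *; rewrite mulr0 scaler0. Qed.

Lemma hochschild_dD f g :
  hochschild_d (f + g) = hochschild_d f + hochschild_d g.
Proof. by rewrite -[f]scale1r hochschild_d_linear !scale1r. Qed.

(** For a left factor of fixed parity, the Koszul sign only affects the right
    factor. *)
Lemma cup_parE p f g : par p f ->
  cup f g = conv f (if odd p then ceps g else g).
Proof.
move=> fp; apply/funext => s; apply: eq_cut => u v _.
have [->|fu] := par_case u fp; first by rewrite !mul0r scaler0.
by case: ifP => p1; rewrite ?/ceps -?alg_scalerAr signE oddM fu p1 // signE.
Qed.

Lemma mlin_cup f g : mlin f -> mlin g -> mlin (cup f g).
Proof.
move=> fl gl; rewrite (part_sum false f) -[part _ f]scale1r cup_combl.
have H (b : bool) : mlin (cup (part (fun n => odd n != b) f) g).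
  rewrite (cup_parE g (@par_part b f)); apply: mlin_conv.
    exact: mlin_part.
  by case: ifP => // _; apply: mlin_ceps.
by apply: mlinD; [apply: mlinZ|].
Qed.

Lemma cup_cochain f g : cochain f -> cochain g -> cochain (cup f g).
Proof.
move=> fc gc; have [[M fM] [N gN]] := (supp_cochain fc, supp_cochain gc).
apply: cochain_supp; first by apply: mlin_cup; apply: cochain_mlin.
exists (M + N)%N => s Ns; apply: cut_zero => u v es.
case: (leqP M (size u)) => [/fM ->|lt_u]; first by rewrite mul0r scaler0.
rewrite [g v]gN ?mulr0 ?scaler0 //.
by move: Ns lt_u; rewrite es size_cat; lia.
Qed.

Lemma par_d p f : mlin f -> par p f -> par p.+1 (hochschild_d f).
Proof.
move=> fl fp; apply: par_ext (fun s => esym (hochschild_d_par s fl fp)) _.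
move=> s Ns; rewrite (par_conv (@par_iota _ A) fp) //.
rewrite (par_ins (@par_mu _ A) fp fl); last by move: Ns; rewrite /= negbK.
by rewrite (par_conv fp (@par_iota _ A)) ?scaler0 ?subr0 // addn1.
Qed.

Lemma d_cup f g : mlin f -> mlin g ->
  hochschild_d (cup f g) = cup (hochschild_d f) (ceps g) +
                           cup f (hochschild_d g).
Proof.
move=> fl gl.
have H p h : par p h -> mlin h -> hochschild_d (cup h g) =
    cup (hochschild_d h) (ceps g) + cup h (hochschild_d g).
  move=> hp hl; rewrite !(cup_parE _ hp) (cup_parE _ (par_d hl hp)) /=.
  apply/funext => s; rewrite fctE if_neg cepsK.
  have gl' : mlin (if odd p then ceps g else g).
    by case: ifP => // _; apply: mlin_ceps.
  rewrite (d_conv _ hl gl' hp); congr (_ + _); rewrite signE; case: (odd p) gl'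
    => // _.
  rewrite d_ceps // -[RHS]opprK; congr (- _); rewrite -convNr.
  exact: eq_conv.
rewrite {1}(part_sum false f) cupDl hochschild_dD.
rewrite !(H _ _ (@par_part _ f)); try exact: mlin_part.
by rewrite addrACA -!cupDl -hochschild_dD -part_sum.
Qed.

Lemma cup_operation2 : operation2 cup.
Proof.
split.
- move=> f g fz gz; split; first by apply: cup_cochain; [case: fz|case: gz].
  rewrite d_cup; [|exact: cocycle_mlin|exact: cocycle_mlin].
  by rewrite (proj2 fz) (proj2 gz) cup0l cup0r addr0.
- exact: cup_combl.
- exact: cup_combr.
- move=> h g hc gz; exists (cup h (ceps g)); split.
    by apply: cup_cochain => //; apply: cochain_ceps; case: gz.
  have gl := cocycle_mlin gz; rewrite d_cup; [|exact: cochain_mlin|exact: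
    mlin_ceps].
  by rewrite cepsK (proj2 (cocycle_ceps gz)) cup0r addr0.
move=> f h fz hc; exists (cup f h); split.
  by apply: cup_cochain => //; case: fz.
rewrite d_cup; [|exact: cocycle_mlin|exact: cochain_mlin].
by rewrite (proj2 fz) cup0l add0r.
Qed.

Lemma cup_conv p q f g : par p f -> par q g ->
  cup f g = (-1) ^+ (p * q) *: conv f g.
Proof.
move=> fp gq; apply/funext => s; rewrite fctE /conv cutZ.
apply: eq_cut => u v _; have [->|fu] := par_case u fp.
  by rewrite !mul0r !scaler0.
by have [->|gv] := par_case v gq; [rewrite !mulr0 !scaler0|sgn].
Qed.

Lemma cupA f g h : cup f (cup g h) = cup (cup f g) h.
Proof.
apply/funext => s; rewrite /cup.
transitivity (cut s (fun u r => cut r (fun v w =>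
    (-1) ^+ (size u * (size v + size w) + size v * size w) *:
    (f u * g v * h w)))).
  apply: eq_cut => u r _.
  rewrite (cut_raddf (f := *%R (f u))); last exact: mulrDr.
  rewrite cutZ; apply: eq_cut => v w ->.
  by rewrite -alg_scalerAr mulrA; sgn.
rewrite cutA; apply: eq_cut => u w _.
rewrite (cut_raddf (f := fun a : A => a * h w)) => [|a b]; last exact: mulrDl.
rewrite cutZ; apply: eq_cut => v v' ->.
by rewrite -alg_scalerAl; sgn.
Qed.

Lemma cup1l f : cup cone f = f.
Proof.
apply/funext => s; rewrite /cup cut_l0 /= => [|a u v].
  by rewrite mul0n expr0 scale1r mul1r.
by rewrite mul0r scaler0.
Qed.

Lemma cup1r f : cup f cone = f.
Proof.
apply/funext => s; rewrite /cup cut_r0 /= => [|u a v].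
  by rewrite muln0 expr0 scale1r mulr1.
by rewrite mulr0 scaler0.
Qed.

Lemma cocycle_cone : is_cocycle (@cone _ A).
Proof.
apply: is_cocycleI => [|s].
  apply: cochain_supp; first exact: mlin_one.
  by exists 1%N; case.
rewrite hochschild_dE; last exact: mlin_one.
rewrite conv1r conv1l ins_one subr0.
have [->|s1] := par_case s (@par_iota _ A); first by rewrite scaler0 addr0.
by rewrite signE s1 subrr.
Qed.

End Lifting.

(** * The Batalin-Vilkovisky structure on cohomology *)

Section Structure.
Variables (k : comPzRingType) (A : algebra k) (tau : A -> k^o).
Hypothesis tauP : trace_form tau.
Implicit Types (s t u v w : seq A) (a b : A) (c : k).
Implicit Types (f g h : seq A -> A) (p q m n : nat).
Local Notation HH := (hochschild_cohomology A).

Lemma hochschild_d_comb c f g s : hochschild_d (fun t => c *: f t + g t) s =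
  c *: hochschild_d f s + hochschild_d g s.
Proof. by have := hochschild_d_linear c f g; move/(congr1 (@^~ s)). Qed.

Lemma cochain_comb c f g : cochain f -> cochain g ->
  cochain (fun t => c *: f t + g t).
Proof. exact: (proj2 (cochain_submod A)). Qed.

Lemma hochschild_dZ c f s :
  hochschild_d (fun t => c *: f t) s = c *: hochschild_d f s.
Proof.
have := hochschild_d_linear c f 0; rewrite hochschild_d0 !addr0.
by move/(congr1 (@^~ s)).
Qed.

Lemma cochainZ c f : cochain f -> cochain (fun t => c *: f t).
Proof.
move=> fc; have := cochain_comb c fc (proj1 (cochain_submod A)).
by congr cochain; apply/funext => s; rewrite /= addr0.
Qed.

Lemma cochain_ins p f g : cochain f -> cochain g -> cochain (ins p f g).
Proof.
move=> fc gc; have [[M fM] [N gN]] := (supp_cochain fc, supp_cochain gc).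
have [fl gl] := (cochain_mlin fc, cochain_mlin gc).
apply: cochain_supp; first exact: mlin_ins.
by exists (M + N)%N; apply: supp_ins.
Qed.

Lemma cochain_ins2 p q f g h : cochain f -> cochain g -> cochain h ->
  cochain (ins2 p f q g h).
Proof.
move=> fc gc hc.
have [M fM] := supp_cochain fc; have [N gN] := supp_cochain gc.
have [K hK] := supp_cochain hc.
move: fc gc hc => /cochain_mlin fl /cochain_mlin gl /cochain_mlin hl.
apply: cochain_supp; first exact: mlin_ins2.
by exists (M + N + K)%N; apply: supp_ins2.
Qed.

Lemma cochain_bracketP p q f g : cochain f -> cochain g -> cochain (bracket p q
  f g).
Proof.
move=> fc gc; rewrite (_ : bracket _ _ _ _ =
  fun t => - (-1) ^+ (p.+1 * q.+1) *: ins p f g t + ins q g f t).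
  by apply: cochain_comb; apply: cochain_ins.
by apply/funext => t; rewrite /bracket scaleNr addrC.
Qed.

Lemma cocycle_bracket p q f g : is_cocycle f -> is_cocycle g -> par p f -> par
  q g ->
  is_cocycle (bracket p q f g).
Proof.
move=> fz gz fp gq; apply: is_cocycleI; first by apply: cochain_bracketP;
  [case: fz|case: gz].
exact: (par_cocycle_d (par_cocycle_bracket (is_cocycle_par fz fp)
  (is_cocycle_par gz gq))).
Qed.

Lemma cocycle_conv p q f g : is_cocycle f -> is_cocycle g -> par p f -> par q g
  -> is_cocycle (conv f g).
Proof.
move=> fz gz fp gq; have := operation2_cocycle (cup_operation2 A) fz gz.
rewrite (cup_conv fp gq) => /(cocycleZ ((-1) ^+ (p * q))).
by rewrite scalerA -exprD signE addnn odd_double.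
Qed.

Lemma cochain_connes f : cochain f -> cochain (connes tau f).
Proof.
move=> fc; have [[N fN] fl] := (supp_cochain fc, cochain_mlin fc).
apply: cochain_supp; first exact: mlin_connes.
by exists N; apply: supp_connes.
Qed.

Lemma cocycle_connes f : is_cocycle f -> is_cocycle (connes tau f).
Proof.
case=> fc fd; apply: is_cocycleI => [|s]; first exact: cochain_connes.
apply/eqP; rewrite -oppr_eq0 -connes_d //; last exact: cochain_mlin.
by rewrite fd connes_zero //; exact: mlin0.
Qed.

Lemma cochain_half_homotopy p f g : cochain f -> cochain g -> par_cocycle p f ->
  cochain (half_homotopy tau p f g).
Proof.
move=> fc gc fp; have [[M fM] [N gN]] := (supp_cochain fc, supp_cochain gc).
have gl := cochain_mlin gc.
apply: cochain_supp; first exact: mlin_half_homotopy.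
by exists (M + N)%N; apply: supp_half_homotopy.
Qed.

(** The Batalin-Vilkovisky operator, with the sign for which it satisfies
    the identity for the cup product [cup]. *)
Definition signed_connes f := ceps (connes tau f).

Lemma signed_connes_operation : operation signed_connes.
Proof.
split=> [f fz|c f g fc gc|h hc]; first exact/cocycle_ceps/cocycle_connes.
  rewrite /signed_connes -ceps_comb; congr ceps; apply/funext => s.
  by rewrite -[c *: f + g]/(fun t => c *: f t + g t) connes_comb //;
    apply: cochain_mlin.
exists (signed_connes h); split; first exact/cochain_ceps/cochain_connes.
have hl := cochain_mlin hc.
rewrite /signed_connes d_ceps; last exact: mlin_connes.
by apply/funext => s; rewrite !fctE /ceps connes_d // scalerN.
Qed.

Lemma connes_ceps f s : mlin f -> connes tau (ceps f) s = - ceps (connes tau f)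
  s.
Proof.
move=> fl; apply: (trace_sep tauP) => a; rewrite mulrN /ceps -alg_scalerAr.
rewrite (traceN tauP) (traceZ tauP) !connesE //; last exact: mlin_ceps.
rewrite -signS /cycsum cutZ; apply: eq_cut => x y ->.
by rewrite /ceps (traceZ tauP); sgn.
Qed.

(** The bounding cochain comes from evaluating [connes tau f] on lists that
    start with the unit of [A]. *)
Lemma signed_connes_sq f : is_cocycle f -> boundary (signed_connes
  (signed_connes f)).
Proof.
move=> fz; have fl := cocycle_mlin fz.
exists (fun s => (-1) *: flat tau (cycsum id (fun s => tau (connes tau f (1 ::
  s)))) s).
split.
  apply: cochainZ.
  have [N fN] := supp_cochain (proj1 (cocycle_connes fz)).
  have b1l : mlin (fun s => tau (connes tau f (1 :: s))).
    exact/(mlin_trace tauP)/(mlin_head [:: 1])/mlin_connes.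
  apply: cochain_supp.
    apply: mlin_flat => // *; first exact: (linear_cycsum (cyc_op_id _)).
    exact: (mlin_cycsum (cyc_op_id _)).
  exists N; apply: supp_flat => // [t|a].
    exact: (linear_cycsum (cyc_op_id _)).
  apply: supp_cycsum_id => s Ns; rewrite fN ?(trace0 tauP) //=.
  exact: leqW.
apply/funext => s; rewrite hochschild_dZ -connes_connes //; last by move=> t;
  rewrite cocycle_d.
rewrite /signed_connes /ceps connes_ceps; last exact: mlin_connes.
by rewrite /ceps scaleN1r; signed_abel.
Qed.

Lemma ceps_par p f : par p f -> ceps f = (-1) ^+ p *: f.
Proof.
move=> fp; apply/funext => s; rewrite fctE /ceps.
by have [->|fs] := par_case s fp; [rewrite !scaler0|sgn].
Qed.

(** The cup product is commutative on classes. *)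
Lemma cls_conv_comm p q f g : is_cocycle f -> is_cocycle g -> par p f -> par q
  g ->
  cls (conv f g) = (-1) ^+ (p * q) *: cls (conv g f).
Proof.
move=> fz gz fp gq; have [fc gc] := (is_cocycle_par fz fp, is_cocycle_par gz
  gq).
rewrite -clsZ; last exact: cocycle_conv gz fz gq fp.
apply: (cls_eq (h := fun s => (-1) ^+ p *: ins p f g s)).
- exact: cocycle_conv fz gz fp gq.
- exact/cocycleZ/(cocycle_conv gz fz gq fp).
- by apply/cochainZ/cochain_ins; [case: fz|case: gz].
move=> s; rewrite hochschild_dZ (d_ins _ fc gc) fctE.
signed_abel.
Qed.

Local Notation B := (hlift signed_connes).
Local Notation E := (hlift (@ceps _ A)).
Local Notation M := (hlift2 (@cup _ A)).

Lemma class_connes_linear : linear B.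
Proof. exact: hlift_linear signed_connes_operation. Qed.

Lemma class_cup_linearl y : linear (M^~ y).
Proof. exact: hlift2_linearl (cup_operation2 A). Qed.

Lemma class_cup_linearr x : linear (M x).
Proof. exact: hlift2_linearr (cup_operation2 A). Qed.

Lemma linear_at0 (V W : lmodType k) (F : V -> W) : linear F -> F 0 = 0.
Proof. by move=> Fl; have := Fl (-1) 0 0; rewrite scaleN1r addNr scaleN1r
  addNr. Qed.

Lemma linear_atD (V W : lmodType k) (F : V -> W) :
  linear F -> {morph F : x y / x + y}.
Proof. by move=> Fl x y; have := Fl 1 x y; rewrite !scale1r. Qed.

Lemma linear_atZ (V W : lmodType k) (F : V -> W) c x :
  linear F -> F (c *: x) = c *: F x.
Proof. by move=> Fl; have := Fl c x 0; rewrite (linear_at0 Fl) !addr0. Qed.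

Lemma cls_cup p q f g : is_cocycle f -> is_cocycle g -> par p f -> par q g ->
  M (cls f) (cls g) = (-1) ^+ (p * q) *: cls (conv f g).
Proof.
move=> fz gz fp gq; rewrite (hlift2E (cup_operation2 A)) //.
by rewrite (cup_conv fp gq) clsZ //; apply: cocycle_conv fz gz fp gq.
Qed.

Lemma cls_signed_connes p f : is_cocycle f -> par p f ->
  B (cls f) = (-1) ^+ p.+1 *: cls (connes tau f).
Proof.
move=> fz fp; rewrite (hliftE signed_connes_operation fz) /signed_connes.
rewrite (ceps_par (par_connes tauP (cocycle_mlin fz) fp)) clsZ //; exact:
  cocycle_connes.
Qed.

Lemma cls_ceps p f : is_cocycle f -> par p f -> E (cls f) = (-1) ^+ p *: cls f.
Proof.
by move=> fz fp; rewrite (hliftE (@ceps_operation _ A) fz) (ceps_par fp) clsZ.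
Qed.

(** The bracket of two classes, read off the Batalin-Vilkovisky identity; [E]
    accounts for the signs by the degree of [x]. *)
Definition class_bracket (x y : HH) : HH := B (M (E x) y) - M (B (E x)) y - M x
  (B y).

(** The bracket of classes is induced by the bracket of cochains. *)
Lemma cls_bracket p q f g : is_cocycle f -> is_cocycle g -> par p f -> par q g
  ->
  class_bracket (cls f) (cls g) = cls (bracket p q f g).
Proof.
move=> fz gz fp gq; have [fc gc] := (is_cocycle_par fz fp, is_cocycle_par gz
  gq).
have [fl gl] := (cocycle_mlin fz, cocycle_mlin gz).
have [bfz bgz] := (cocycle_connes fz, cocycle_connes gz).
have [bfp bgq] := (par_connes tauP fl fp, par_connes tauP gl gq).
have fgz := cocycle_conv fz gz fp gq.
have fgp := par_conv fp gq.
have bfgz := cocycle_connes fgz.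
have bfcz := cocycle_conv bfz gz bfp gq.
have fbcz := cocycle_conv fz bgz fp bgq.
transitivity (cls ((-1) ^+ (q + p * q) *: conv (connes tau f) g +
  ((-1) ^+ (q + p * q).+1 *: connes tau (conv f g) +
   (-1) ^+ (p * q.+1 + q) *: conv f (connes tau g)))).
  rewrite !clsP //; [|exact: cocycleZ|exact/cocycle_comb/cocycleZ]; rewrite
    clsZ //.
  rewrite /class_bracket (cls_ceps fz fp) (cls_signed_connes gz gq).
  rewrite (linear_atZ _ _ (class_cup_linearl _)) !(linear_atZ _ _
    class_connes_linear).
  rewrite (cls_signed_connes fz fp) !(linear_atZ _ _ (class_cup_linearl _)).
  rewrite (linear_atZ _ _ (class_cup_linearr _)).
  rewrite (cls_cup fz gz fp gq) (linear_atZ _ _ class_connes_linear)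
    (cls_signed_connes fgz fgp).
  rewrite (cls_cup bfz gz bfp gq) (cls_cup fz bgz fp bgq).
  signed_abel.
have fg : cochain f /\ cochain g by split; [case: fz|case: gz].
(* The two cyclic homotopies, and the one that exchanges the factors of
   [conv f (connes tau g)]. *)
pose h s := (-1) ^+ (p.+1 * q.+1) *: half_homotopy tau p f g s +
  ((-1) *: half_homotopy tau q g f s +
   (-1) ^+ (q + p * q).+1 *: ins p f (connes tau g) s).
symmetry; apply: (cls_eq (h := h)).
- exact: cocycle_bracket.
- by apply: cocycle_comb => //; apply: cocycle_comb => //; apply: cocycleZ.
- case: fg => ? ?; apply: cochain_comb; first exact: cochain_half_homotopy.
  apply: cochain_comb; first exact: cochain_half_homotopy.
  by apply/cochainZ/cochain_ins => //; case: bgz.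
move=> s; rewrite !hochschild_d_comb hochschild_dZ scaleN1r.
rewrite (bracket_connes tauP _ fc gc) (d_ins _ fc (is_cocycle_par bgz bgq))
  !fctE.
signed_abel.
Qed.

Lemma class_bracket_linearl y : linear (class_bracket^~ y).
Proof.
move=> c x x'; have El := hlift_linear (@ceps_operation _ A).
rewrite /class_bracket El class_connes_linear !class_cup_linearl
  class_connes_linear !scalerBr.
abel.
Qed.

Lemma class_bracket_linearr x : linear (class_bracket x).
Proof.
move=> c y y'; rewrite /class_bracket !(class_cup_linearr, class_connes_linear)
  !scalerBr.
abel.
Qed.

(** Additive maps that agree on the classes of even and of odd cocycles are
    equal. *)
Lemma eq_additive (W : zmodType) (F G : HH -> W) z :
  {morph F : x y / x + y} -> {morph G : x y / x + y} ->
  (forall n h, is_cocycle h -> par n h -> F (cls h) = G (cls h)) -> F z = G z.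
Proof.
move=> FD GD eFG; have [h [hz <-]] := cls_surj z.
rewrite (part_sum false h) clsD; [|exact: cocycle_part|exact: cocycle_part].
by rewrite FD GD !(eFG _ _ (cocycle_part _ hz) (@par_part _ _ _ h)).
Qed.

Lemma class_bracket_leibniz p q f g z : is_cocycle f -> is_cocycle g -> par p f
  -> par q g ->
  class_bracket (cls f) (M (cls g) z) = M (class_bracket (cls f) (cls g)) z +
    (-1) ^+ (p.+1 * q) *: M (cls g) (class_bracket (cls f) z).
Proof.
move=> fz gz fp gq; have [fc gc] := (is_cocycle_par fz fp, is_cocycle_par gz
  gq).
have brD x := linear_atD (class_bracket_linearr x).
have MD x := linear_atD (class_cup_linearr x).
apply: (@eq_additive _ (fun z => class_bracket (cls f) (M (cls g) z))
  (fun z => M (class_bracket (cls f) (cls g)) z +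
    (-1) ^+ (p.+1 * q) *: M (cls g) (class_bracket (cls f) z))).
- by move=> x y; rewrite MD brD.
- by move=> x y; rewrite MD brD MD scalerDr addrACA.
move=> n h hz hn; have hc := is_cocycle_par hz hn.
have ghz := cocycle_conv gz hz gq hn; have ghp := par_conv gq hn.
have [fl gl hl] := And3 (cocycle_mlin fz) (cocycle_mlin gz) (cocycle_mlin hz).
have fgz := cocycle_bracket fz gz fp gq; have fgp := par_bracket fl gl fp gq.
have fhz := cocycle_bracket fz hz fp hn; have fhp := par_bracket fl hl fp hn.
have fghz := cocycle_conv fgz hz fgp hn.
have gfhz := cocycle_conv gz fhz gq fhp.
rewrite (cls_cup gz hz gq hn) (linear_atZ _ _ (class_bracket_linearr _)).
rewrite (cls_bracket fz ghz fp ghp) (cls_bracket fz gz fp gq) (cls_bracket fz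
  hz fp hn).
rewrite (cls_cup fgz hz fgp hn) (cls_cup gz fhz gq fhp).
have -> : cls (bracket p (q + n) f (conv g h)) =
    cls (conv g (bracket p n f h)) +
    (-1) ^+ (p.+1 * n) *: cls (conv (bracket p q f g) h).
  rewrite addrC -clsP //.
  apply: (cls_eq (h := fun s => (-1) ^+ (n + q * n) *: ins2 q g n h f s)).
  - exact: cocycle_bracket.
  - exact: cocycle_comb.
  - by apply/cochainZ/cochain_ins2; [case: gz|case: hz|case: fz].
  move=> s; rewrite hochschild_dZ (bracket_conv _ gc hc fc) !fctE.
  by congr (_ + _); apply: addrC.
signed_abel.
Qed.

Lemma class_bracket_jacobi p q f g z : is_cocycle f -> is_cocycle g -> par p f
  -> par q g ->
  class_bracket (cls f) (class_bracket (cls g) z) = class_bracket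
    (class_bracket (cls f) (cls g)) z +
    (-1) ^+ (p.+1 * q.+1) *: class_bracket (cls g) (class_bracket (cls f) z).
Proof.
move=> fz gz fp gq.
have brD x := linear_atD (class_bracket_linearr x).
apply: (@eq_additive _ (fun z => class_bracket (cls f) (class_bracket (cls g)
  z))
  (fun z => class_bracket (class_bracket (cls f) (cls g)) z +
    (-1) ^+ (p.+1 * q.+1) *: class_bracket (cls g) (class_bracket (cls f) z))).
- by move=> x y; rewrite !brD.
- by move=> x y; rewrite !brD scalerDr addrACA.
move=> n h hz hn.
have [fl gl hl] := And3 (cocycle_mlin fz) (cocycle_mlin gz) (cocycle_mlin hz).
have fgz := cocycle_bracket fz gz fp gq; have fgp := par_bracket fl gl fp gq.
have fhz := cocycle_bracket fz hz fp hn; have fhp := par_bracket fl hl fp hn.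
have ghz := cocycle_bracket gz hz gq hn; have ghp := par_bracket gl hl gq hn.
rewrite (cls_bracket gz hz gq hn) (cls_bracket fz gz fp gq) (cls_bracket fz hz
  fp hn).
rewrite (cls_bracket fz ghz fp ghp) (cls_bracket fgz hz fgp hn) (cls_bracket gz
  fhz gq fhp).
rewrite addrC -clsP; [|exact: cocycle_bracket|exact: cocycle_bracket].
congr cls; apply/funext => s; rewrite bracket_jacobi // !fctE addrC.
by [].
Qed.

Lemma class_bracket_anti p q f g : is_cocycle f -> is_cocycle g -> par p f ->
  par q g ->
  class_bracket (cls f) (cls g) = - ((-1) ^+ (p.+1 * q.+1) *: class_bracket
    (cls g) (cls f)).
Proof.
move=> fz gz fp gq; rewrite (cls_bracket fz gz fp gq) (cls_bracket gz fz gq fp).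
rewrite -signS -clsZ; last exact: cocycle_bracket.
congr cls; apply/funext => s; rewrite fctE /bracket.
signed_abel.
Qed.

Lemma class_connes_sq x : B (B x) = 0.
Proof.
have [f [fz <-]] := cls_surj x; have bop := signed_connes_operation.
have bfz := operation_cocycle bop fz; have bbfz := operation_cocycle bop bfz.
rewrite !(hliftE bop) // -(@cls0 _ A); apply: cls_boundary => //; first exact:
  cocycle0.
by rewrite subr0; apply: signed_connes_sq.
Qed.

(** * Homogeneous cochains *)

Lemma homogeneous_par p f : homogeneous p f -> par p f.
Proof. by move=> fp s Ns; apply: fp; apply: contra Ns => /eqP ->. Qed.

Lemma ins_homogeneous p q f g s : homogeneous p f -> homogeneous q g ->
  mlin g -> (size s).+1 != (p + q)%N -> ins p f g s = 0.
Proof.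
move=> fp gq gl Ns; apply: cut_zero => u r es; apply: cut_zero => v w er.
have [fv|fv] := eqVneq (size v) p; last by rewrite fp // slot0 // scaler0.
rewrite gq ?scaler0 //; apply: contra Ns => /eqP gs; apply/eqP.
by move: gs; rewrite es er !size_cat /= fv; lia.
Qed.

Lemma homogeneous_part n f : homogeneous n (part (pred1 n) f).
Proof. by move=> s Ns; rewrite /part /= (negPf Ns). Qed.

Lemma homogeneous_cup p q f g : homogeneous p f -> homogeneous q g ->
  homogeneous (p + q) (cup f g).
Proof.
move=> fp gq s Ns; apply: cut_zero => u v es.
have [fu|fu] := eqVneq (size u) p; last by rewrite fp // mul0r scaler0.
rewrite [g v]gq ?mulr0 ?scaler0 //; apply: contra Ns => /eqP gv.
by rewrite es size_cat fu gv.
Qed.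

(** On homogeneous cochains [cup] is the cup product of fixed degrees. *)
Lemma cup_homogeneous p q f g : homogeneous p f -> homogeneous q g ->
  cup f g = cochain_cup A p q f g.
Proof.
move=> fp gq; apply/funext => s; rewrite /cup cutE /cochain_cup.
case: (ltnP (size s) p) => [lt_p|le_p].
  rewrite (fp (take p s)) ?mul0r ?scaler0; last first.
    by rewrite take_oversize ?ltn_eqF // ltnW.
  apply: big1 => i _; rewrite fp ?mul0r ?scaler0 //.
  by rewrite size_take; case: ifP => _; rewrite ltn_eqF //; move: (ltn_ord i);
    lia.
have ltp : (p < (size s).+1)%N by [].
rewrite (bigD1 (Ordinal ltp)) //= big1 ?addr0 => [|i /eqP ip].
  rewrite size_takel //; have [<- //|gs] := eqVneq (size (drop p s)) q.
  by rewrite [g _]gq // mulr0 !scaler0.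
rewrite fp ?mul0r ?scaler0 // size_takel; last by rewrite -ltnS.
by apply/eqP => e; apply: ip; apply: val_inj.
Qed.

Lemma circ_homogeneous p q f g : homogeneous p f -> homogeneous q g ->
  mlin f -> cochain_circ p q f g = ins q g f.
Proof.
move=> fp gq fl; apply/funext => s; rewrite /cochain_circ.
have [es|Ns] := eqVneq (size s).+1 (p + q)%N; last first.
  rewrite (ins_homogeneous gq fp fl) 1?addnC // big1 // => i _.
  have [gs|gs] := eqVneq (size (take q (drop i s))) q; last first.
    by rewrite gq // slot0 // scaler0.
  rewrite fp ?scaler0 //; move: gs (ltn_ord i) Ns.
  by rewrite size_cat /= !size_take_min !size_drop; lia.
rewrite /ins cutE.
(* The added terms vanish: for [p <= i] too few letters are left for [g]. *)
rewrite (big_ord_widen (size s).+1 (fun i => (-1) ^+ (i * q.+1) *: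
  f (take i s ++ g (take q (drop i s)) :: drop (i + q) s))); last by rewrite es
    leq_addr.
rewrite big_mkcond; apply: eq_bigr => i _; rewrite cutE.
have is_ : (i <= size s)%N by rewrite -ltnS.
case: ltnP => [lt_i|le_i]; last first.
  rewrite big1 // => j _; rewrite gq ?slot0 ?scaler0 //.
  rewrite size_takel; last by rewrite -ltnS.
  by apply/eqP => jq; move: (ltn_ord j) le_i; rewrite jq size_drop; lia.
have ltq : (q < (size (drop i s)).+1)%N by rewrite size_drop; lia.
rewrite (bigD1 (Ordinal ltq)) //= big1 ?addr0 => [|j /eqP jq].
  by rewrite drop_drop (addnC q) size_takel.
rewrite gq ?slot0 ?scaler0 // size_takel; last by rewrite -ltnS.
by apply/eqP => e; apply: jq; apply: val_inj.
Qed.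

Lemma bracket_homogeneous p q f g : homogeneous p f -> homogeneous q g ->
  mlin f -> mlin g -> cochain_bracket A p q f g = bracket p q f g.
Proof.
move=> fp gq fl gl; rewrite /cochain_bracket !circ_homogeneous //.
Qed.

End Structure.

(** * The grading *)

Section Grading.
Variables (k : comPzRingType) (A : algebra k).
Implicit Types (s t u v w : seq A) (a b : A) (c : k).
Implicit Types (f g h : seq A -> A) (p q m n : nat).
Local Notation HH := (hochschild_cohomology A).

Lemma degreeP n (x : HH) : cohomology_degree A n x <->
  exists f, [/\ is_cocycle f, homogeneous n f & cls f = x].
Proof.
split=> [[z [zn <-]]|[f [/cocycle_ex[z <-] fn <-]]].
  by exists z; split=> //; [exact: cocycle_valP|exact: cls_val].
by exists z; split=> //; rewrite cls_val.
Qed.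

Lemma cls_sum N (F : nat -> seq A -> A) : (forall i, is_cocycle (F i)) ->
  is_cocycle (\sum_(i < N) F i) /\ cls (\sum_(i < N) F i) = \sum_(i < N) cls (F
    i).
Proof.
move=> Fz; elim: N => [|N [IHz IHN]].
  by rewrite !big_ord0 cls0; split=> //; apply: cocycle0.
rewrite !big_ord_recr /= clsD // IHN; split=> //.
exact: cocycleD.
Qed.

Lemma sum_fctE N (F : nat -> seq A -> A) s :
  (\sum_(i < N) F i) s = \sum_(i < N) F i s.
Proof. by elim: N => [|N IHN]; rewrite ?big_ord0 // !big_ord_recr /= fctE IHN.
  Qed.

(** The components of a cocycle are cocycles, and a relation between classes
    of different degrees splits into its components. *)
Lemma cohomology_graded : graded_module (@cohomology_degree k A).
Proof.
split.
- move=> n; apply/degreeP; exists 0; split=> //; [exact: cocycle0|exact: cls0].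
- move=> n c x y /degreeP[f [fz fn <-]] /degreeP[g [gz gn <-]].
  apply/degreeP; exists (c *: f + g); split; first exact: cocycle_comb.
    by move=> s Ns; rewrite !fctE fn // gn // scaler0 addr0.
  by rewrite clsP.
- move=> x; have [f [fz <-]] := cls_surj x.
  have [N fN] := supp_cochain (proj1 fz).
  exists N, (fun i => cls (part (pred1 i) f)); split=> [i|].
    apply/degreeP; exists (part (pred1 i) f); split=> //; first exact:
      cocycle_part.
    exact: homogeneous_part.
  have [_ <-] := cls_sum N (fun i => cocycle_part (pred1 i) fz).
  congr cls; apply/funext => s.
  rewrite (sum_fctE _ (fun i => part (pred1 i) f)).
  case: (ltnP (size s) N) => [lt_s|le_s]; last first.
    by rewrite fN // big1 // => i _; rewrite /part fN //; case: ifP.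
  rewrite (bigD1 (Ordinal lt_s)) //= big1 /part ?addr0 /= ?eqxx // => i.
  by rewrite -val_eqE /= eq_sym => /negPf ->.
move=> N c cP c0 i lt_i.
have [F FP] := choice (fun j => proj1 (degreeP j (c j)) (cP j)).
have Fz j : is_cocycle (F j) by have [] := FP j.
have [Sz Sc] := cls_sum N Fz.
have S0 : cls (\sum_(j < N) F j) = cls (0 : seq A -> A).
  by rewrite Sc cls0 -[RHS]c0; apply: eq_bigr => j _; have [] := FP j.
have [h [hc hd]] := proj1 (cls_eqP Sz (cocycle0 A)) S0.
have [_ Fi <-] := FP i; rewrite -(cls0 A); apply: cls_boundary => //.
  exact: cocycle0.
rewrite subr0; exists (part (fun n => n.+1 == i) h); split.
  exact: cochain_part.
apply/funext => s; rewrite d_part hd subr0 /part.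
have sumE : size s = i -> (\sum_(j < N) F j) s = F i s.
  move=> si; rewrite sum_fctE (bigD1 (Ordinal lt_i)) //= big1 ?addr0 // => j.
  rewrite -val_eqE /= => ji; have [_ Fj _] := FP j.
  by apply: Fj; rewrite si eq_sym.
have [s0|s0] := posnP (size s); last first.
  rewrite prednK //; case: eqVneq => [/sumE //|si].
  by rewrite Fi.
(* The differential vanishes on the empty list. *)
have F0 : (\sum_(j < N) F j) s = 0.
  by have := congr1 (@^~ s) hd; rewrite /= subr0 (size0nil s0) => <-.
rewrite F0 if_same; have [si|si] := eqVneq (size s) i; last by rewrite Fi.
by rewrite -sumE.
Qed.

End Grading.

Arguments degreeP {k A n x}.

(** * The Batalin-Vilkovisky algebra *)

Section BVAlgebra.
Variables (k : comPzRingType) (A : algebra k) (tau : A -> k^o).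
Hypothesis tauP : trace_form tau.
Implicit Types (f g h : seq A -> A) (p q m n : nat).

Local Notation B := (hlift (signed_connes tau)).
Local Notation M := (hlift2 (@cup _ A)).

Lemma cohomology_gerstenhaber :
  gerstenhaber_algebra (@cohomology_degree k A) M (class_bracket tau).
Proof.
have cop := cup_operation2 A.
split.
- exact: cohomology_graded.
- exact: class_cup_linearl.
- exact: class_cup_linearr.
- move=> p q x y /degreeP[f [fz fp <-]] /degreeP[g [gz gq <-]].
  apply/degreeP; exists (cup f g); split; last by rewrite (hlift2E cop).
    exact: operation2_cocycle.
  exact: homogeneous_cup.
- move=> x y z; have [f [fz <-]] := cls_surj x.
  have [g [gz <-]] := cls_surj y; have [h [hz <-]] := cls_surj z.
  have [fgz ghz] := (operation2_cocycle cop fz gz, operation2_cocycle cop gz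
    hz).
  by rewrite !(hlift2E cop) // cupA.
- exists (cls cone).
    apply/degreeP; exists cone; split=> //; first exact: cocycle_cone.
    by case.
  by split=> x; have [f [fz <-]] := cls_surj x;
    rewrite (hlift2E cop) ?cup1l ?cup1r //; apply: cocycle_cone.
- move=> p q x y /degreeP[f [fz fp <-]] /degreeP[g [gz gq <-]].
  move: fp gq => /homogeneous_par fp /homogeneous_par gq.
  rewrite (cls_cup fz gz fp gq) (cls_cup gz fz gq fp) (cls_conv_comm fz gz fp
    gq).
  by rewrite (mulnC q); sgn.
- exact: class_bracket_linearl.
- exact: class_bracket_linearr.
- move=> p q r x y pqr /degreeP[f [fz fp <-]] /degreeP[g [gz gq <-]].
  have [fp' gq'] := (homogeneous_par fp, homogeneous_par gq).
  apply/degreeP; exists (bracket p q f g); split; first exact: cocycle_bracket.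
    move=> s Ns; rewrite /bracket (ins_homogeneous gq fp (cocycle_mlin fz)).
      rewrite (ins_homogeneous fp gq (cocycle_mlin gz)) ?scaler0 ?subr0 //.
      by rewrite pqr.
    by rewrite addnC pqr.
  by rewrite (cls_bracket tauP fz gz fp' gq').
- move=> x y /degreeP[f [fz fp <-]] /degreeP[g [gz gq <-]].
  have [fp' gq'] := (homogeneous_par fp, homogeneous_par gq).
  rewrite (cls_bracket tauP fz gz fp' gq') -(cls0 A); congr cls.
  apply/funext => s; rewrite /bracket (ins_homogeneous gq fp (cocycle_mlin fz))
    //.
  by rewrite (ins_homogeneous fp gq (cocycle_mlin gz)) // scaler0 subr0.
- move=> p q x y /degreeP[f [fz fp <-]] /degreeP[g [gz gq <-]].
  by apply: (class_bracket_anti tauP) => //; apply: homogeneous_par.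
- move=> p q x y z /degreeP[f [fz fp <-]] /degreeP[g [gz gq <-]].
  by apply: (class_bracket_jacobi tauP) => //; apply: homogeneous_par.
move=> p q x y z /degreeP[f [fz fp <-]] /degreeP[g [gz gq <-]].
by apply: (class_bracket_leibniz tauP) => //; apply: homogeneous_par.
Qed.

Lemma signed_connes_homogeneous n f s : mlin f -> homogeneous n f ->
  (size s).+1 != n -> signed_connes tau f s = 0.
Proof.
move=> fl fn Ns; rewrite /signed_connes /ceps.
rewrite (_ : connes tau f s = 0) ?scaler0 //; apply: (trace_sep tauP) => a.
rewrite connesE // mulr0 (trace0 tauP); apply: cut_zero => x y es.
rewrite fn ?(trace0 tauP) ?scaler0 //; apply: contra Ns.
by rewrite es !size_cat /= addnS addnC.
Qed.

Lemma cohomology_bv :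
  batalin_vilkovisky_algebra (@cohomology_degree k A) M (class_bracket tau).
Proof.
have bop := signed_connes_operation tauP.
split; first exact: cohomology_gerstenhaber.
exists B; split.
- exact: class_connes_linear.
- move=> n x /degreeP[f [fz fn <-]]; apply/degreeP; exists (signed_connes tau
  f).
  split; [exact: operation_cocycle|move=> s Ns|by rewrite (hliftE bop)].
  exact: signed_connes_homogeneous (cocycle_mlin fz) fn _.
- move=> x /degreeP[f [fz fn <-]]; rewrite (hliftE bop) // -(cls0 A).
  by congr cls; apply/funext => s; rewrite (signed_connes_homogeneous
    (cocycle_mlin fz) fn).
- exact: class_connes_sq.
move=> p x y /degreeP[f [fz /homogeneous_par fp <-]].
have Bl := class_connes_linear tauP; have Ml := @class_cup_linearl _ A.
rewrite /class_bracket (cls_ceps fz fp) (linear_atZ _ _ (Ml _)) !(linear_atZ _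
  _ Bl).
rewrite (linear_atZ _ _ (Ml _)).
signed_abel.
Qed.

End BVAlgebra.

Theorem corollary6p4 (k : comPzRingType) (A : algebra k) :
  symmetric_algebra A ->
  exists cup br : hochschild_cohomology A -> hochschild_cohomology A ->
                  hochschild_cohomology A,
    [/\ induced_by (cochain_cup A) cup,
        induced_by (cochain_bracket A) br
      & batalin_vilkovisky_algebra (cohomology_degree A) cup br].
Proof.
move=> /symmetric_trace[tau tauP]; exists (hlift2 (@cup _ A)), (class_bracket
  tau).
split; last exact: cohomology_bv.
  move=> p q f g fp gq; have [fz gz] := (cocycle_valP f, cocycle_valP g).
  have [h hE] := cocycle_ex (operation2_cocycle (cup_operation2 A) fz gz).
  exists h; split; first by rewrite hE (cup_homogeneous fp gq).
  by rewrite -!cls_val hE (hlift2E (cup_operation2 A)).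
move=> p q f g fp gq; have [fz gz] := (cocycle_valP f, cocycle_valP g).
have [fp' gq'] := (homogeneous_par fp, homogeneous_par gq).
have [h hE] := cocycle_ex (cocycle_bracket fz gz fp' gq').
exists h; split.
  by rewrite hE bracket_homogeneous //; apply: cocycle_mlin.
by rewrite -!cls_val hE (cls_bracket tauP fz gz fp' gq').
Qed.
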